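(* Let $d\ge1$ and consider nearest-neighbor random walk on $\mathbb{Z}^d$ in a uniformly elliptic space--time product environment. Let $\xi\in\mathrm{int}(\mathcal{D})$ and suppose that the quenched large deviation principle for the mean velocity holds in a neighborhood of $\xi$ with rate $I_a(\xi)$ at $\xi$. Then for all $N,M,K\in\mathbb{N}$, every bounded measurable function $f:\Omega\times U^{\mathbb{N}}\to\mathbb{R}$ such that $f(\cdot,(z_i)_{i\ge1})$ is independent of $(z_i)_{i>K}$ and is $\mathcal{B}_{-N}^+\cap\mathcal{B}_M^-$-measurable for each $(z_i)_{i\ge1}$, and every $\epsilon>0$, there exists $\delta_o>0$ such that for every $\delta$ with $0<\delta<\delta_o$, $\mathbb{P}$-a.s. $$\limsup_{n\to\infty}\frac1n\log P_{o,o}^\omega\bigl(A_{\xi,n}^{\epsilon}(f)\,\big|\,D_{\xi,n}^{\delta}\bigr)<0,$$ where $$A_{\xi,n}^\epsilon(f)=\Bigl\{\Bigl|\frac1n\sum_{j=0}^{n-1}f\bigl(T_{j,X_j}\omega,(Z_{j+i})_{i\ge1}\bigr)-\int f\,d\overline{\mu}_\xi^\infty\Bigr|>\epsilon\Bigr\},\qquad D_{\xi,n}^\delta=\Bigl\{\Bigl|\frac{X_n}{n}-\xi\Bigr|\le\delta\Bigr\}.$$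
   Context: Environment. $U=\{z\in\mathbb{Z}^d: |z|=1\}$. An environment is $\omega=(\omega_{n,x})_{n\in\mathbb{Z},x\in\mathbb{Z}^d}$, where $\omega_{n,x}=(\pi_{n,n+1}(x,x+y))_{y\in\mathbb{Z}^d}$ is a probability vector. $\Omega$ is the product space of all environments, with Borel $\sigma$-algebra $\mathcal{B}$, and $\mathbb{P}$ is a product probability measure on $\Omega$ under which the $\omega_{n,x}$ are i.i.d. Standing assumptions: (nearest-neighbor) $\mathbb{P}(\pi_{0,1}(0,z)>0)=0$ unless $z\in U$; (uniform ellipticity) there is a constant $c>0$ with $\mathbb{P}(\pi_{0,1}(0,z)\ge c)=1$ for all $z\in U$. $\mathcal{B}_n^+$ (resp. $\mathcal{B}_n^-$) is the $\sigma$-algebra generated by $(\omega_{m,x}: x\in\mathbb{Z}^d, m\ge n)$ (resp. $m\le n$). Shifts: $(T_{m,y}\omega)_{n,x}=\omega_{n+m,x+y}$. Walk. For fixed $\omega$, $P_{k,x}^\omega$ (the quenched measure) is the law of the Markov chain $(X_n)_{n\ge k}$ with $X_k=x$ and probability $\pi_{n,n+1}(y,y+z)$ of stepping from $y$ at time $n$ to $y+z$ at time $n+1$. The averaged measure is the semi-direct product $P_{k,x}=\mathbb{P}\times P_{k,x}^\omega$. Expectations: $\mathbb{E},E_{k,x}^\omega,E_{k,x}$. The subscript $o,o$ means start at position $0$ at time $0$. $Z_{n+1}=X_{n+1}-X_n$. Averaged rate function. $q(z)=\mathbb{E}[\pi_{0,1}(0,z)]$, $\phi(\theta)=\sum_{z\in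 U}q(z)e^{\langle\theta,z\rangle}$ for $\theta\in\mathbb{R}^d$, $I_a(\xi)=\sup_{\theta\in\mathbb{R}^d}\{\langle\theta,\xi\rangle-\log\phi(\theta)\}$, and $\mathcal{D}=\{\xi\in\mathbb{R}^d: I_a(\xi)<\infty\}$. Measure $\overline{\mu}_\xi^\infty$. For $\xi\in\mathrm{int}(\mathcal{D})$ there is a unique $\theta\in\mathbb{R}^d$ with $\xi=\nabla\log\phi(\theta)$. $\overline{\mu}_\xi^\infty$ is the probability measure on $\Omega\times U^{\mathbb{N}}$ determined by $$\int f\,d\overline{\mu}_\xi^\infty=E_{o,o}\bigl[e^{\langle\theta,X_{N+M+K+1}\rangle-(N+M+K+1)\log\phi(\theta)}f(T_{N,X_N}\omega,(Z_{N+i})_{i\ge1})\bigr]$$ for all $N,M,K\in\mathbb{N}$ and all bounded measurable $f:\Omega\times U^{\mathbb{N}}\to\mathbb{R}$ such that $f(\cdot,(z_i)_{i\ge1})$ is independent of $(z_i)_{i>K}$ and $\mathcal{B}_{-N}^+\cap\mathcal{B}_M^-$-measurable for each $(z_i)_{i\ge1}$. Convention: $\log 0=-\infty$. Local quenched LDP. The hypothesis means: there are an open set $O\ni\xi$ and a lower semicontinuous $I:O\to[0,\infty]$ with $I(\xi)=I_a(\xi)$ such that for $\mathbb{P}$-a.e. $\omega$, $\liminf_{n\to\infty}\frac1n\log P_{o,o}^\omega(X_n/n\in G)\ge-\inf_{G}I$ for every open $G\subset O$, and $\limsup_{n\to\infty}\frac1n\log P_{o,o}^\omega(X_n/n\in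 F)\le-\inf_{F}I$ for every $F\subset O$ that is closed in $\mathbb{R}^d$. *)

(* Defs.v *)
From HB Require Import structures.
From mathcomp Require Import all_boot all_order all_algebra.
From mathcomp Require Import all_classical all_reals all_analysis.

Set Implicit Arguments.
Unset Strict Implicit.
Unset Printing Implicit Defensive.

Import Order.TTheory GRing.Theory Num.Theory.
Import numFieldNormedType.Exports.

Local Open Scope classical_set_scope.
Local Open Scope ring_scope.

(* The dimension is written d.+1 throughout: this is exactly the range
   "dimension at least 1", and makes the set of unit steps inhabited. *)

Definition dot {R : realType} {n : nat} (u v : 'rV[R]_n) : R :=
  \sum_(i < n) u 0 i * v 0 i.

(* The norm of the library on row vectors is the sup norm, under which the unit
   sphere of Z^d is not the set of nearest neighbours. *)
Definition enorm {R : realType} {n : nat} (u : 'rV[R]_n) : R :=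
  Num.sqrt (dot u u).

Definition vecZ (R : realType) {n : nat} (z : 'rV[int]_n) : 'rV[R]_n :=
  map_mx intr z.

Definition gradient {R : realType} {d : nat} (g : 'rV[R]_d.+1 -> R)
    (theta : 'rV[R]_d.+1) : 'rV[R]_d.+1 :=
  \row_(i < d.+1) 'D_(delta_mx 0 i) g theta.

(* The sets generating the sigma-algebra of the maps X i for i in J, where C is
   the sigma-algebra of their codomain *)
Definition coord_sets {T I S : Type} (C : set (set S)) (J : set I)
    (X : I -> T -> S) : set (set T) :=
  [set X i @^-1` B | i in J & B in C].

Record unit_step (R : realType) (d : nat) := UnitStep {
  step_val :> 'rV[int]_d.+1;
  _ : enorm (vecZ R step_val) == 1 }.

HB.instance Definition _ R d := [isSub for @step_val R d].
HB.instance Definition _ R d := [Choice of unit_step R d by <:].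

Lemma enorm_e0 (R : realType) (d : nat) :
  enorm (vecZ R (delta_mx 0 0 : 'rV[int]_d.+1)) == 1.
Proof.
rewrite /enorm /dot big_ord_recl big1 => [|i _]; rewrite !mxE/= ?mulr0//.
by rewrite !mulr1 addr0 sqrtr1.
Qed.

HB.instance Definition _ R d :=
  isPointed.Build (unit_step R d) (UnitStep (enorm_e0 R d)).

Record prob_vector (R : realType) (d : nat) := ProbVector {
  pv_val :> 'rV[int]_d.+1 -> R;
  _ : forall y, 0 <= pv_val y;
  _ : (\esum_(y in [set: 'rV[int]_d.+1]) (pv_val y)%:E = 1)%E }.

HB.instance Definition _ R d := gen_eqMixin (prob_vector R d).
HB.instance Definition _ R d := gen_choiceMixin (prob_vector R d).

Lemma pv0_ge0 (R : realType) (d : nat) (y : 'rV[int]_d.+1) :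
  0 <= (y == 0)%:R :> R.
Proof. exact: ler0n. Qed.

Lemma pv0_sum1 (R : realType) (d : nat) :
  (\esum_(y in [set: 'rV[int]_d.+1]) ((y == 0)%:R : R)%:E = 1)%E.
Proof.
transitivity (\esum_(y in [set 0%R : 'rV[int]_d.+1]) (1 : \bar R))%E.
  rewrite [RHS]esum_mkcond; apply: eq_esum => y _.
  case: (eqVneq y 0) => [->|y0]; first by rewrite mem_set.
  by rewrite memNset//=; exact/eqP.
by rewrite esum_set1.
Qed.

HB.instance Definition _ R d :=
  isPointed.Build (prob_vector R d) (ProbVector (@pv0_ge0 R d) (pv0_sum1 R d)).

(* Countable products of separable metric spaces: the Borel sigma-algebras are
   generated by the coordinates, both here and for environments. *)
Definition pv_coords (R : realType) (d : nat) : set (set (prob_vector R d)) :=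
  coord_sets measurable [set: 'rV[int]_d.+1] (fun y (p : prob_vector R d) => p y).

HB.instance Definition _ R d :=
  Measurable.copy (prob_vector R d) (g_sigma_algebraType (@pv_coords R d)).

Definition env (R : realType) (d : nat) : Type :=
  int -> 'rV[int]_d.+1 -> prob_vector R d.

(* pi_{n,n+1}(x, x + z) *)
Definition trans (R : realType) (d : nat) (w : env R d) (n : int)
  (x z : 'rV[int]_d.+1) : R := w n x z.

Definition site (R : realType) (d : nat) (s : int * 'rV[int]_d.+1)
  (w : env R d) : prob_vector R d := w s.1 s.2.

HB.instance Definition _ R d :=
  Pointed.copy (env R d) (int -> 'rV[int]_d.+1 -> prob_vector R d).

Definition env_coords (R : realType) (d : nat) : set (set (env R d)) :=
  coord_sets measurable [set: int * 'rV[int]_d.+1] (@site R d).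

HB.instance Definition _ R d :=
  Measurable.copy (env R d) (g_sigma_algebraType (@env_coords R d)).

Definition future_sigma (R : realType) (d : nat) (n : int) :
    set (set (env R d)) :=
  <<s coord_sets measurable [set s | n <= s.1] (@site R d) >>.

Definition past_sigma (R : realType) (d : nat) (n : int) :
    set (set (env R d)) :=
  <<s coord_sets measurable [set s | s.1 <= n] (@site R d) >>.

Definition shift (R : realType) (d : nat) (m : int) (y : 'rV[int]_d.+1)
  (w : env R d) : env R d := fun n x => w (n + m) (x + y).

(* z i stands for the (i+1)-st coordinate of a sequence indexed from 1 *)
Definition steps (R : realType) (d : nat) : Type := nat -> unit_step R d.

HB.instance Definition _ R d :=
  Pointed.copy (steps R d) (nat -> unit_step R d).

Definition steps_coords (R : realType) (d : nat) : set (set (steps R d)) :=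
  coord_sets [set: set (unit_step R d)] [set: nat]
    (fun i (z : steps R d) => z i).

HB.instance Definition _ R d :=
  Measurable.copy (steps R d) (g_sigma_algebraType (@steps_coords R d)).

Definition walk (d : nat) : Type := nat -> 'rV[int]_d.+1.

HB.instance Definition _ d := gen_eqMixin (walk d).
HB.instance Definition _ d := gen_choiceMixin (walk d).
HB.instance Definition _ d := isPointed.Build (walk d) (fun=> 0).

Definition walk_coords (d : nat) : set (set (walk d)) :=
  coord_sets [set: set 'rV[int]_d.+1] [set: nat] (fun i (v : walk d) => v i).

HB.instance Definition _ d :=
  Measurable.copy (walk d) (g_sigma_algebraType (@walk_coords d)).

(* The increments (Z_{j+1}, Z_{j+2}, ...) of a path.  A walk in a
   nearest-neighbour environment a.s. never takes a step outside of the unit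
   sphere; on this null set the increment is replaced by the default point. *)
Definition incr (R : realType) (d : nat) (v : walk d) (j : nat) : steps R d :=
  fun i => insubd (point : unit_step R d) (v (j + i).+1 - v (j + i)%N).

Section random_walk.
Context (R : realType) (d : nat).
Local Open Scope ereal_scope.

(* Product probability measure with identical marginals *)
Definition iid_env (P : probability (env R d) R) : Prop :=
  forall (r : seq (int * 'rV[int]_d.+1))
      (B : int * 'rV[int]_d.+1 -> set (prob_vector R d)),
    uniq r -> (forall s, measurable (B s)) ->
    P [set w | forall s, s \in r -> B s (site s w)] =
    \prod_(s <- r) P [set w | B s (site (0%R, 0%R) w)].

Definition nearest_neighbor (P : probability (env R d) R) : Prop :=
  forall z : 'rV[int]_d.+1, enorm (vecZ R z) <> 1%R ->
    P [set w | 0 < trans w 0 0 z]%R = 0.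

Definition uniformly_elliptic (P : probability (env R d) R) : Prop :=
  exists2 c : R, (0 < c)%R &
    forall z : unit_step R d, P [set w | c <= trans w 0 0 z]%R = 1.

(* Q is the law of (X_{k+i})_{i >= 0}, for the Markov chain in the environment w
   that is at x at time k. *)
Definition quenched_law (w : env R d) (k : int) (x : 'rV[int]_d.+1)
    (Q : probability (walk d) R) : Prop :=
  forall (n : nat) (u : walk d),
    Q [set v | forall i, (i <= n)%N -> v i = u i] =
    ((u 0%N == x)%:R *
     \prod_(i < n) trans w (k + i%:Z) (u i) (u i.+1 - u i))%R%:E.

(* E_{o,o}: expectation under the semi-direct product of P and the quenched laws *)
Definition averaged_expectation (P : probability (env R d) R)
    (Q : env R d -> probability (walk d) R) (g : env R d -> walk d -> R) :
    \bar R :=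
  \int[P]_w \int[Q w]_v (g w v)%:E.

Definition mean_step (P : probability (env R d) R) (z : 'rV[int]_d.+1) : R :=
  fine 'E_P[fun w => trans w 0 0 z].

Definition phi (P : probability (env R d) R) (theta : 'rV[R]_d.+1) : R :=
  (\sum_(z \in [set: unit_step R d])
    mean_step P z * expR (dot theta (vecZ R z)))%R.

Definition log_phi (P : probability (env R d) R) (theta : 'rV[R]_d.+1) : R :=
  ln (phi P theta).

Definition I_a (P : probability (env R d) R) (xi : 'rV[R]_d.+1) : \bar R :=
  ereal_sup (range (fun theta => (dot theta xi - log_phi P theta)%:E)).

Definition domain_I_a (P : probability (env R d) R) : set 'rV[R]_d.+1 :=
  [set xi | I_a P xi < +oo].

Definition mean_velocity (n : nat) (v : walk d) : 'rV[R]_d.+1 :=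
  (n%:R^-1 *: vecZ R (v n))%R.

Definition quenched_ldp_near (P : probability (env R d) R)
    (Q : env R d -> probability (walk d) R) (xi : 'rV[R]_d.+1) : Prop :=
  exists (O : set 'rV[R]_d.+1) (I : 'rV[R]_d.+1 -> \bar R),
  [/\ open O /\ O xi,
      forall x, O x -> 0 <= I x,
      forall x, O x -> forall a : R, a%:E < I x ->
        exists2 V, nbhs x V & forall y, V y -> O y -> a%:E < I y,
      I xi = I_a P xi &
      {ae P, forall w,
        (forall G, open G -> G `<=` O ->
          - ereal_inf [set I x | x in G] <=
          limn_einf (fun n =>
            n%:R^-1%:E * lne (Q w [set v | G (mean_velocity n v)]))) /\
        (forall F, closed F -> F `<=` O ->
          limn_esup (fun n =>
            n%:R^-1%:E * lne (Q w [set v | F (mean_velocity n v)])) <=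
          - ereal_inf [set I x | x in F])}].

(* Bounded measurable f that depends on z through its first K coordinates only
   and on the environment through the times in [-N, M] only. *)
Definition local_function (N M K : nat) (f : env R d * steps R d -> R) :
    Prop :=
  [/\ exists C : R, forall a, (`|f a| <= C)%R,
      measurable_fun setT f,
      forall w (z z' : steps R d),
        (forall i, (i < K)%N -> z i = z' i) -> f (w, z) = f (w, z') &
      forall (z : steps R d) (B : set R), measurable B ->
        (@future_sigma R d (- N%:Z) `&` @past_sigma R d M%:Z)
          [set w | B (f (w, z))]].

Definition is_mubar (P : probability (env R d) R)
    (Q : env R d -> probability (walk d) R) (theta : 'rV[R]_d.+1)
    (mu : probability (env R d * steps R d)%type R) : Prop :=
  forall (N M K : nat) (f : env R d * steps R d -> R), local_function N M K f ->
    \int[mu]_a (f a)%:E =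
    averaged_expectation P Q (fun w v =>
      let L := (N + M + K).+1 in
      expR (dot theta (vecZ R (v L)) - L%:R * log_phi P theta) *
      f (shift N%:Z (v N) w, incr R v N))%R.

(* 0 by convention when Q D = 0; the logarithm below is then -oo *)
Definition cond_prob (Q : probability (walk d) R) (A D : set (walk d)) : R :=
  (fine (Q (A `&` D)) / fine (Q D))%R.

Definition event_A (mu : probability (env R d * steps R d)%type R)
    (f : env R d * steps R d -> R) (eps : R) (w : env R d) (n : nat) :
    set (walk d) :=
  [set v | eps < `|n%:R^-1 *
      (\sum_(0 <= j < n) f (shift j%:Z (v j) w, incr R v j))
      - \int[mu]_a f a|]%R.

Definition event_D (xi : 'rV[R]_d.+1) (delta : R) (n : nat) : set (walk d) :=
  [set v | enorm (mean_velocity n v - xi) <= delta]%R.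

End random_walk.

(* Main.v *)
(** Write J = <theta, xi> - log phi(theta).  Jensen's inequality for the tilted
    step law and xi = grad log phi(theta) give I_a(xi) <= J, so the lower bound
    of the quenched LDP makes the probability of the conditioning event at least
    exp(-n(J + o(1))).  On that event the tilt exp(<theta, X_n> - n log phi(theta))
    is at least exp(n(J - O(delta))), hence it suffices that the averaged tilted
    probability of A decays at a rate independent of delta; a summation over n
    then turns the averaged bound into an almost sure quenched one.

    Under the averaged tilted law the slices of the environment seen from the
    walker, together with the steps, are i.i.d.  The observable at time j depends
    on m = N + M + K + 1 consecutive slices, so within each residue class of times
    modulo m the observables are independent, with mean the integral against
    mubar, and the exponential Chebyshev inequality applies.  Independence is
    expressed by the multiplicativity of the averages of path sums (avg_cat). *)

Require Import Defs.
From HB Require Import structures.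
From mathcomp Require Import all_boot all_order all_algebra.
From mathcomp Require Import all_classical all_reals all_analysis.
From mathcomp Require Import measurable_realfun.
From mathcomp Require Import ring lra zify.

Import Order.TTheory GRing.Theory Num.Theory.
Import numFieldNormedType.Exports.

Set Implicit Arguments.
Unset Strict Implicit.
Unset Printing Implicit Defensive.

Local Open Scope classical_set_scope.
Local Open Scope ring_scope.

(** * Nearest-neighbour paths and their quenched weights *)

Section paths.
Context (R : realType) (d : nat).

Lemma finite_unit_step : finite_set [set: unit_step R d].
Proof.
have le1 (z : unit_step R d) i : (`|step_val z 0 i| <= 1).
  have /eqP : enorm (vecZ R z) == 1 by case: z.
  rewrite /enorm => h.
  have h2 : dot (vecZ R z) (vecZ R z) = 1.
    rewrite -(expr1n R 2) -h sqr_sqrtr// sumr_ge0// => j _.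
    by rewrite -expr2 sqr_ge0.
  have h3 : ((step_val z 0 i)%:~R : R) ^+ 2 <= 1.
    rewrite -[leRHS]h2 /dot (bigD1 i)//= !mxE -expr2 lerDl sumr_ge0// => j _.
    by rewrite -expr2 sqr_ge0.
  rewrite -(ler_int R) intr_norm -(@expr_le1 _ 2)// real_normK ?num_real//.
(* The coordinates of a unit step lie in {-1, 0, 1}; adding one embeds the steps in a finite
   type. *)
pose g (z : unit_step R d) : 'rV['I_3]_d.+1 :=
  \row_i inord (absz (step_val z 0 i + 1)).
have inj : injective g.
  move=> z z' /rowP e; apply/val_inj/rowP => i.
  have := e i; rewrite !mxE => /(congr1 (@nat_of_ord _)).
  have b (y : unit_step R d) :
      (absz (step_val y 0 i + 1)%R < 3)%N /\ 0 <= step_val y 0 i + 1.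
    have := le1 y i; rewrite ler_norml => /andP[? ?]; split; last by lia.
    by lia.
  rewrite !inordK ?(b z).1 ?(b z').1// => e2.
  have [_ b1] := b z; have [_ b2] := b z'; rewrite /=; lia.
rewrite -(preimage_setT g); apply: finite_preimage => //; first by move=> ? ? _ _ /inj.
Qed.

Definition nn_steps : seq 'rV[int]_d.+1 :=
  [seq step_val z | z <- finmap.enum_fset (fset_set [set: unit_step R d])].

Lemma mem_nn_steps z : (z \in nn_steps) = (enorm (vecZ R z) == 1).
Proof.
apply/mapP/idP => [[[y hy]] _ -> //|hz].
exists (UnitStep hz) => //.
have : UnitStep hz \in [set: unit_step R d] by rewrite inE.
by rewrite -in_fset_set//; exact: finite_unit_step.
Qed.

Lemma uniq_nn_steps : uniq nn_steps.
Proof. by rewrite map_inj_uniq ?finmap.fset_uniq//; exact: val_inj. Qed.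

Definition consw (z : 'rV[int]_d.+1) (v : walk d) : walk d :=
  fun i => if i is j.+1 then z + v j else 0.

(** An enumerated path is frozen at its endpoint after time [a], so that functions of an entire walk
    can be evaluated on it. *)
Fixpoint paths (a : nat) : seq (walk d) :=
  if a is b.+1 then [seq consw z v | z <- nn_steps, v <- paths b]
  else [:: (fun=> 0) : walk d].

Definition catw (a : nat) (u v : walk d) : walk d :=
  fun i => if (i <= a)%N then u i else u a + v (i - a)%N.

Definition tailw (a : nat) (v : walk d) : walk d := fun i => v (a + i)%N - v a.

Definition wt (a : nat) (w : env R d) (u : walk d) : R :=
  \prod_(i < a) trans w i%:Z (u i) (u i.+1 - u i).

Lemma paths_start a v : v \in paths a -> v 0%N = 0.
Proof.
case: a => [|a]; first by rewrite inE => /eqP ->.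
by move=> /allpairsP[[z u]] [_ _ ->].
Qed.

Lemma paths_step a v i : v \in paths a -> (i < a)%N ->
  v i.+1 - v i \in nn_steps.
Proof.
elim: a v i => [//|a IH] v i /allpairsP[[z u]] /= [zU uP ->].
case: i => [_|i]; first by rewrite /= subr0 (paths_start uP) addr0.
by rewrite ltnS /= opprD addrACA subrr add0r; exact: IH.
Qed.

Lemma big_paths_cat a b (F : walk d -> R) :
  \sum_(v <- paths (a + b)) F v =
  \sum_(u <- paths a) \sum_(v <- paths b) F (catw a u v).
Proof.
elim: a F => [|a IH] F.
  rewrite big_seq1 add0n; apply: eq_big_seq => v vP; congr F.
  apply/funext => -[|i]; rewrite /catw/= ?(paths_start vP)//.
  by rewrite add0r subn0.
rewrite !big_allpairs_dep/=; apply: eq_bigr => z _; rewrite IH.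
apply: eq_bigr => u _; apply: eq_bigr => v _; congr F; apply/funext => -[|i]//.
by rewrite /catw/= ltnS; case: ifP => // _; rewrite subSS addrA.
Qed.

Lemma catw_add a (u v : walk d) i : v 0%N = 0 ->
  catw a u v (a + i)%N = u a + v i.
Proof.
move=> v0; rewrite /catw; case: i => [|i]; first by rewrite addn0 leqnn v0 addr0.
by rewrite addnS ltnNge leq_addr/= -addnS addKn.
Qed.

Lemma wt_cat a b w (u v : walk d) : v 0%N = 0 ->
  wt (a + b) w (catw a u v) = wt a w u * wt b (Defs.shift a%:Z (u a) w) v.
Proof.
move=> v0; rewrite /wt big_split_ord/=; congr *%R.
  by apply: eq_bigr => i _; rewrite /catw ltn_ord (ltnW (ltn_ord i)).
apply: eq_bigr => i _; rewrite -addnS !catw_add// opprD addrACA subrr add0r.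
by rewrite /trans /Defs.shift [i%:Z + _]addrC [X in _ = w _ X _]addrC.
Qed.

Lemma tailw_catw a (u v : walk d) : v 0%N = 0 -> tailw a (catw a u v) = v.
Proof.
move=> v0; apply/funext => i; rewrite /tailw catw_add//.
by rewrite /catw leqnn addrC addKr.
Qed.

Lemma catwE a (u v : walk d) i : (i <= a)%N -> catw a u v i = u i.
Proof. by rewrite /catw => ->. Qed.

Definition cyl (a : nat) (u : walk d) : set (walk d) :=
  [set v | forall i, (i <= a)%N -> v i = u i].

Definition nn_walk (a : nat) : set (walk d) :=
  [set v | v 0%N = 0 /\ forall i, (i < a)%N -> v i.+1 - v i \in nn_steps].

(** A nearest-neighbour walk from the origin lies in exactly one enumerated cylinder: its first step
    is forced, and the walk recentred at time 1 falls under the induction hypothesis. *)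
Lemma sum_indic_cyl a v : nn_walk a v ->
  \sum_(u <- paths a) \1_(cyl a u) v = 1 :> R.
Proof.
elim: a v => [|a IH] v [v0 hv].
  by rewrite big_seq1 indicE mem_set// => i; rewrite leqn0 => /eqP ->.
rewrite big_allpairs_dep/=.
have ? : v 1%N \in nn_steps by have := hv 0%N isT; rewrite v0 subr0.
rewrite (bigD1_seq (v 1%N)) ?uniq_nn_steps//= [X in _ + X]big1 => [|z zv].
  rewrite addr0 -[RHS](IH (tailw 1 v)).
    apply: eq_bigr => u _; rewrite !indicE; congr ((nat_of_bool _)%:R).
    apply/idP/idP; rewrite !inE => h.
      by move=> i ia; rewrite /tailw add1n h//= addrC addKr.
    case => [|i] ia; first by rewrite v0.
    by rewrite /= -h// /tailw addrC subrK.
  split; first by rewrite /tailw subrr.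
  by move=> i ia; rewrite /tailw !add1n opprB addrA subrK; exact: hv.
rewrite big1_seq// => u /= uP; rewrite indicE memNset// => /(_ 1%N isT) /= vz.
by move: zv; rewrite vz (paths_start uP) addr0 eqxx.
Qed.

(** The quenched expectation of [G] over nearest-neighbour paths, as a finite sum. Its measurability
    in the environment is inherited from [G], while no measurability of the kernel [Q] is
    assumed. *)
Definition path_sum (a : nat) (G : env R d -> walk d -> R) (w : env R d) : R :=
  \sum_(u <- paths a) wt a w u * G w u.

Definition catG (a : nat) (G G' : env R d -> walk d -> R) : env R d -> walk d -> R :=
  fun w v => G w v * G' (Defs.shift a%:Z (v a) w) (tailw a v).

(** Markov property at time [a]: the weight of a concatenated path factors, the second factor being
    read in the environment seen from the walker. *)
Lemma path_sum_cat a b (G G' : env R d -> walk d -> R) w :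
    (forall w v v', (forall i, (i <= a)%N -> v i = v' i) -> G w v = G w v') ->
  path_sum (a + b) (catG a G G') w =
  \sum_(u <- paths a) wt a w u * G w u * path_sum b G' (Defs.shift a%:Z (u a) w).
Proof.
move=> hG; rewrite /path_sum big_paths_cat; apply: eq_bigr => u _.
rewrite big_distrr/=; apply: eq_big_seq => v /paths_start v0.
rewrite wt_cat// /catG tailw_catw// catwE// (hG _ _ u) => [|i ?]; last exact: catwE.
by rewrite mulrACA.
Qed.

End paths.

Arguments paths R {d} a.
Arguments nn_walk R {d} a.

(** * Independence across times *)

Section environment.
Context (R : realType) (d : nat).
Implicit Types (w : env R d).

Lemma trans_ge0 w n x z : 0 <= trans w n x z.
Proof. by rewrite /trans; case: (w n x). Qed.

Lemma trans_le1 w n x z : trans w n x z <= 1.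
Proof.
rewrite /trans; case: (w n x) => p p0 p1 /=; rewrite -lee_fin -p1.
by apply: esum_ge; exists [set z]; rewrite ?fsbig_set1//; split.
Qed.

Lemma wt_ge0 a w u : 0 <= wt a w u.
Proof. by apply: prodr_ge0 => i _; exact: trans_ge0. Qed.

Lemma measurable_site s : measurable_fun setT (@site R d s).
Proof.
move=> _ B mB; rewrite setTI; apply: sub_sigma_algebra.
by exists s => //; exists B.
Qed.

Lemma measurable_pv y : measurable_fun setT (fun p : prob_vector R d => p y).
Proof.
move=> _ B mB; rewrite setTI; apply: sub_sigma_algebra.
by exists y => //; exists B.
Qed.

Lemma measurable_trans n x z :
  measurable_fun setT (fun w : env R d => trans w n x z).
Proof.
exact: (measurableT_comp (measurable_pv z) (measurable_site (n, x))).
Qed.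

Lemma measurable_env {dT} {T : measurableType dT} (g : T -> env R d) :
  (forall s, measurable_fun setT (fun t => site s (g t))) ->
  measurable_fun setT g.
Proof.
move=> mg; apply: (measurability (@env_coords R d)) => // A.
move=> [_ [s _ [B mB <-]] <-]; exact: (mg s measurableT B mB).
Qed.

Lemma measurable_shift m x : measurable_fun setT (@Defs.shift R d m x).
Proof.
by apply: measurable_env => s; exact: (measurable_site (s.1 + m, s.2 + x)).
Qed.

Lemma measurable_wt a u : measurable_fun setT (fun w : env R d => wt a w u).
Proof. by apply: measurable_prod => i _; exact: measurable_trans. Qed.

(** The second environment is stored relative to the space-time point [(m, x)], so shifting by this
    point recovers it at nonnegative times. *)
Definition glue (m : int) (x : 'rV[int]_d.+1) (ww : env R d * env R d) : env R d :=
  fun n y => if n < m then ww.1 n y else ww.2 (n - m) (y - x).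

Lemma measurable_glue m x : measurable_fun setT (glue m x).
Proof.
apply: measurable_env => s; rewrite /site /glue; case: (s.1 < m).
  exact: (measurableT_comp (measurable_site s) measurable_fst).
exact: (measurableT_comp (measurable_site (s.1 - m, s.2 - x)) measurable_snd).
Qed.

(** The pi-system of finite cylinders, on which [iid_env] prescribes the measure. *)
Definition site_sets : set (set (env R d)) :=
  [set A | exists r B, [/\ uniq r, forall s, measurable (B s) &
    A = [set w | forall s, s \in r -> B s (site s w)]]].

Lemma measurable_site_set (r : seq _) (B : _ -> set (prob_vector R d)) :
  (forall s, measurable (B s)) ->
  measurable [set w | forall s, s \in r -> B s (site s w)].
Proof.
move=> mB; rewrite (_ : mkset _ = \big[setI/setT]_(s <- r) (site s @^-1` B s)).
  apply: bigsetI_measurable => s _; rewrite -[X in measurable X]setTI.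
  exact: measurable_site.
apply/seteqP; split => w /=; rewrite big_seq_cond -bigcap_seq_cond => h s.
  by move=> /= /andP[sr _]; exact: h.
by move=> sr; apply: h => /=; rewrite sr.
Qed.

Lemma site_sets_measurable A : site_sets A -> measurable A.
Proof. by move=> [r [B [_ mB ->]]]; exact: measurable_site_set. Qed.

Lemma site_sets_setI : setI_closed site_sets.
Proof.
move=> _ _ [r [B [ur mB ->]]] [r' [B' [ur' mB' ->]]].
exists (undup (r ++ r')).
exists (fun s => (if s \in r then B s else setT) `&` (if s \in r' then B' s else setT)).
split; first exact: undup_uniq.
  by move=> s; apply: measurableI; case: ifP.
apply/seteqP; split => w /=.
  by move=> [h h'] s; rewrite mem_undup => _; split; case: ifPn => //; [exact: h|exact: h'].
move=> h; split => s sr.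
  by have := h s; rewrite mem_undup mem_cat sr => /(_ isT) [].
by have := h s; rewrite mem_undup mem_cat sr orbT => /(_ isT) [].
Qed.

Lemma site_sets_gen : @measurable _ (env R d) = <<s site_sets >>.
Proof.
apply/seteqP; split; last first.
  apply: smallest_sub; first exact: sigma_algebra_measurable.
  by move=> A /site_sets_measurable.
apply: smallest_sub; first exact: smallest_sigma_algebra.
move=> _ [s _ [B mB <-]]; apply: sub_sigma_algebra.
exists [:: s], (fun=> B); split => //.
apply/seteqP; split => w /=; first by move=> h s'; rewrite inE => /eqP ->.
by apply; rewrite inE.
Qed.

Context (P : probability (env R d) R).
Hypothesis iidP : iid_env P.

(* Pasting two independent environments at time [m], the second one translated
   by [(m, x)], gives back [P]: independence across times and stationarity are
   used in this form only. *)
Lemma glue_law m x (A : set (env R d)) : measurable A ->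
  P A = pushforward (P \x P)%E (glue m x) A.
Proof.
move: A; pose g := glue m x.
have mg : measurable_fun setT g by exact: measurable_glue.
have [pm pmE] : exists pm : {measure set (env R d) -> \bar R},
    forall A, pm A = pushforward (P \x P)%E g A.
  by unshelve eexists (pushforward (P \x P)%E g : {measure set _ -> \bar R}).
move=> A mA; rewrite -pmE; move: A mA.
apply: (measure_unique site_sets (fun=> setT) site_sets_gen site_sets_setI).
- move=> _; exists [::], (fun=> setT); split => //.
  by apply/seteqP; split => w.
- by apply/seteqP; split => // w _; exists 0%N.
- move=> _ [r [B [ur mB ->]]].
  rewrite [LHS](iidP ur mB) pmE.
  (* Sites before time [m] are read in the first environment, the others, translated by [t], in the
     second. Translation leaves the product formula unchanged because every marginal is the one at
     the origin. *)
  pose r1 := [seq s <- r | s.1 < m]; pose r2 := [seq s <- r | ~~ (s.1 < m)].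
  pose t (s : int * 'rV[int]_d.+1) := (s.1 - m, s.2 - x).
  pose t' (s : int * 'rV[int]_d.+1) := (s.1 + m, s.2 + x).
  have tK : cancel t t' by move=> [n y]; rewrite /t/t'/= !subrK.
  have -> : pushforward (P \x P)%E g [set w | forall s, s \in r -> B s (site s w)] =
     (P \x P)%E ([set w | forall s, s \in r1 -> B s (site s w)] `*`
       [set w | forall s, s \in map t r2 -> B (t' s) (site s w)]).
    congr ((P \x P)%E _); apply/seteqP; split => -[w1 w2] /=.
      move=> h; split=> [s|_ /mapP[s + ->]]; rewrite mem_filter => /andP[sm sr].
        by have := h s sr; rewrite /site /g /glue/= sm.
      by have := h s sr; rewrite tK /site /g /glue/= (negbTE sm).
    move=> [h1 h2] s sr; rewrite /site /g /glue/=; case: ifPn => sm.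
      by apply: h1; rewrite mem_filter sm.
    have := h2 (t s); rewrite tK; apply; apply: map_f.
    by rewrite mem_filter sm.
  rewrite product_measure1E; last 2 first.
  - exact (@measurable_site_set r1 B mB).
  - exact (@measurable_site_set (map t r2) (B \o t') (fun s => mB (t' s))).
  have u2 : uniq (map t r2).
    by rewrite map_inj_uniq ?filter_uniq//; exact: can_inj tK.
  have e1 := iidP (filter_uniq (fun s => s.1 < m) ur) mB.
  have e2 := iidP u2 (fun s => mB (t' s)).
  rewrite [X in _ = (X * _)%E]e1 [X in _ = (_ * X)%E]e2 big_map.
  rewrite [X in _ = (_ * X)%E](eq_bigr (fun s => P [set w | B s (site (0, 0) w)])); last first.
    by move=> s _; rewrite tK.
  by rewrite (bigID (fun s => s.1 < m))/= !big_filter.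
- by move=> k /=; rewrite [X in (X < _)%E](@probability_setT _ _ _ P) ltry.
Qed.

Lemma integral_glue (m : int) x (h : env R d -> \bar R) :
  measurable_fun [set: env R d] h -> (forall w, 0 <= h w)%E ->
  (\int[P]_w h w = \int[P]_w1 \int[P]_w2 h (glue m x (w1, w2)))%E.
Proof.
move=> mh h0.
transitivity (\int[pushforward (P \x P) (glue m x)]_w h w)%E.
  unshelve apply: eq_measure_integral; first exact: measurable_glue.
  by move=> ? A mA _; exact: glue_law.
rewrite (ge0_integral_pushforward (measurable_glue m x))//.
rewrite preimage_setT; apply: (fubini_tonelli1 (h \o glue m x)) => [|ww].
  by apply: measurableT_comp => //; exact: measurable_glue.
exact: h0.
Qed.

(** After gluing, [g] sees only the first environment and the shifted [h] only the second, so the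
    double integral factors. *)
Lemma integral_indep m x (g h : env R d -> R) :
    measurable_fun setT g -> measurable_fun setT h ->
    (forall w, 0 <= g w) -> (forall w, 0 <= h w) ->
    (forall w w', (forall n y, n < m -> w n y = w' n y) -> g w = g w') ->
    (forall w w', (forall n y, 0 <= n -> w n y = w' n y) -> h w = h w') ->
  (\int[P]_w (g w * h (Defs.shift m x w))%:E =
   \int[P]_w (g w)%:E * \int[P]_w (h w)%:E)%E.
Proof.
move=> mg mh g0 h0 gm hm.
rewrite (integral_glue m x); last 2 first.
- apply/measurable_EFinP; apply: measurable_funM => //.
  by apply: measurableT_comp => //; exact: measurable_shift.
- by move=> w; rewrite lee_fin mulr_ge0.
transitivity (\int[P]_w1 ((g w1)%:E * \int[P]_w2 (h w2)%:E))%E.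
  apply: eq_integral => w1 _; rewrite -ge0_integralZl//; last 3 first.
  - by apply/measurable_EFinP.
  - by move=> w _; rewrite lee_fin.
  - by rewrite lee_fin.
  apply: eq_integral => w2 _; rewrite EFinM; congr (_%:E * _%:E)%E.
    by apply: gm => n y nm; rewrite /glue nm.
  apply: hm => n y n0; rewrite /Defs.shift /glue.
  by rewrite -subr_lt0 addrK ltNge n0/= !addrK.
rewrite ge0_integralZr//; first by apply/measurable_EFinP.
- by move=> w _; rewrite lee_fin.
- by apply: integral_ge0 => w _; rewrite lee_fin.
Qed.

End environment.

(** * Averages of path sums and the tilt *)

Section admissible.
Context (R : realType) (d : nat).
Implicit Types (w : env R d) (v : walk d) (G : env R d -> walk d -> R).

(* [G] depends on the environment through the times [0, ..., a - 1] and on the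
   walk through its positions at times [0, ..., a]. *)
Record adm (a : nat) G : Prop := Adm {
  adm_ge0 : forall w v, 0 <= G w v ;
  adm_meas : forall v, measurable_fun setT (G^~ v) ;
  adm_env : forall w w' v,
    (forall n y, 0 <= n -> n < a%:Z -> w n y = w' n y) -> G w v = G w' v ;
  adm_walk : forall w v v', (forall i, (i <= a)%N -> v i = v' i) -> G w v = G w v' }.

Lemma wt_env a w w' v : (forall n y, 0 <= n -> n < a%:Z -> w n y = w' n y) ->
  wt a w v = wt a w' v.
Proof. by move=> h; apply: eq_bigr => i _; rewrite /trans h//= ltz_nat. Qed.

Lemma path_sum_env a G w w' : adm a G ->
  (forall n y, 0 <= n -> n < a%:Z -> w n y = w' n y) ->
  path_sum a G w = path_sum a G w'.
Proof.
move=> aG h; apply: eq_bigr => u _; congr (_ * _); first exact: wt_env.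
exact: (adm_env aG).
Qed.

Lemma path_sum_ge0 a G w : (forall w v, 0 <= G w v) -> 0 <= path_sum a G w.
Proof. by move=> G0; apply: sumr_ge0 => u _; rewrite mulr_ge0 ?wt_ge0. Qed.

Lemma measurable_path_sum a G : (forall v, measurable_fun setT (G^~ v)) ->
  measurable_fun setT (path_sum a G).
Proof.
move=> mG; rewrite /path_sum; apply: measurable_sum => u.
by apply: measurable_funM => //; exact: measurable_wt.
Qed.

Lemma adm_cat a b G G' : adm a G -> adm b G' -> adm (a + b) (catG a G G').
Proof.
move=> aG aG'; split.
- by move=> w v; rewrite mulr_ge0 ?(adm_ge0 aG) ?(adm_ge0 aG').
- move=> v; apply: measurable_funM; first exact: (adm_meas aG).
  exact: (measurableT_comp (adm_meas aG' _) (measurable_shift _ _)).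
- move=> w w' v h; rewrite /catG; congr (_ * _).
    by apply: (adm_env aG) => n y n0 na; apply: h => //; lia.
  by apply: (adm_env aG') => n y n0 nb; apply: h; lia.
- move=> w v v' h; rewrite /catG; congr (_ * _).
    by apply: (adm_walk aG) => i ia; apply: h; lia.
  rewrite (h a) ?leq_addr//; apply: (adm_walk aG') => i ib.
  by rewrite /tailw !h ?leq_addr// leq_add2l.
Qed.

Context (P : probability (env R d) R).
Hypothesis iidP : iid_env P.

Definition avg a G : \bar R := (\int[P]_w (path_sum a G w)%:E)%E.

Lemma avg_ge0 a G : (forall w v, 0 <= G w v) -> (0 <= avg a G)%E.
Proof. by move=> G0; apply: integral_ge0 => w _; rewrite lee_fin path_sum_ge0. Qed.

(** Once the path [u] up to time [a] is fixed, its weight and [G] use environment times before [a],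
    and the continuation uses later times recentred at the deterministic point [u a]. By
    [integral_indep] the second factor is the same for every [u] and comes out of the sum. *)
Lemma avg_cat a b G G' : adm a G -> adm b G' ->
  avg (a + b) (catG a G G') = (avg a G * avg b G')%E.
Proof.
move=> aG aG'; rewrite /avg.
under eq_integral do rewrite (@path_sum_cat _ _ a b G G' _ (adm_walk aG)) -sumEFin.
under [X in _ = (X * _)%E]eq_integral do rewrite -sumEFin.
have mP : measurable_fun setT (path_sum b G').
  exact: measurable_path_sum (adm_meas aG').
have mG u : measurable_fun setT (fun w => wt a w u * G w u).
  apply: measurable_funM; [exact: measurable_wt|exact: (adm_meas aG)].
have G0 u w : 0 <= wt a w u * G w u by rewrite mulr_ge0 ?wt_ge0 ?(adm_ge0 aG).
have P0 w : 0 <= path_sum b G' w by apply: path_sum_ge0; exact: adm_ge0 aG'.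
rewrite ge0_integral_sum//; last 2 first.
- move=> u; apply/measurable_EFinP; apply: measurable_funM => //.
  by apply: measurableT_comp => //; exact: measurable_shift.
- by move=> u w _; rewrite lee_fin mulr_ge0.
rewrite ge0_integral_sum//; last 2 first.
- by move=> u; apply/measurable_EFinP.
- by move=> u w _; rewrite lee_fin.
rewrite ge0_sume_distrl; last first.
  by move=> u _; apply: integral_ge0 => w _; rewrite lee_fin.
apply: eq_bigr => u _.
apply: (@integral_indep _ _ _ iidP a%:Z (u a) (fun w => wt a w u * G w u)
  (path_sum b G')) => //.
  move=> w w' h; congr (_ * _).
    by apply: wt_env => n y n0 na; exact: h.
  by apply: (adm_env aG) => n y n0 na; exact: h.
by move=> w w' h; apply: path_sum_env => // n y n0 _; exact: h.
Qed.

Lemma avg_eq a b G G' : a = b -> (forall w v, G w v = G' w v) -> avg a G = avg b G'.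
Proof.
move=> -> h; apply: eq_integral => w _; congr EFin.
by apply: eq_bigr => u _; rewrite h.
Qed.

Lemma avg_add a G G' : adm a G -> adm a G' ->
  avg a (fun w v => G w v + G' w v) = (avg a G + avg a G')%E.
Proof.
move=> aG aG'; rewrite /avg -ge0_integralD//.
- apply: eq_integral => w _; rewrite -EFinD; congr EFin.
  by rewrite -big_split/=; apply: eq_bigr => u _; rewrite mulrDr.
- by move=> w _; rewrite lee_fin path_sum_ge0//; exact: adm_ge0 aG.
- by apply/measurable_EFinP; exact: measurable_path_sum (adm_meas aG).
- by move=> w _; rewrite lee_fin path_sum_ge0//; exact: adm_ge0 aG'.
- by apply/measurable_EFinP; exact: measurable_path_sum (adm_meas aG').
Qed.

Lemma avg_scale a (c : R) G : 0 <= c -> adm a G ->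
  avg a (fun w v => c * G w v) = (c%:E * avg a G)%E.
Proof.
move=> c0 aG; rewrite /avg -ge0_integralZl//.
- apply: eq_integral => w _; rewrite -EFinM; congr EFin.
  by rewrite /path_sum big_distrr/=; apply: eq_bigr => u _; rewrite mulrCA.
- by apply/measurable_EFinP; exact: measurable_path_sum (adm_meas aG).
- by move=> w _; rewrite lee_fin path_sum_ge0//; exact: adm_ge0 aG.
Qed.

Lemma avg_le a G G' : adm a G -> adm a G' -> (forall w v, G w v <= G' w v) ->
  (avg a G <= avg a G')%E.
Proof.
move=> aG aG' h; apply: ge0_le_integral => //.
- by move=> w _; rewrite lee_fin path_sum_ge0//; exact: adm_ge0 aG.
- by apply/measurable_EFinP; exact: measurable_path_sum (adm_meas aG).
- by apply/measurable_EFinP; exact: measurable_path_sum (adm_meas aG').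
- move=> w _; rewrite lee_fin; apply: ler_sum => u _.
  by rewrite ler_wpM2l ?wt_ge0.
Qed.

Lemma adm_comb a (c c' : R) G G' : 0 <= c -> 0 <= c' -> adm a G -> adm a G' ->
  adm a (fun w v => c * G w v + c' * G' w v).
Proof.
move=> c0 c'0 aG aG'; split.
- by move=> w v; rewrite addr_ge0 ?mulr_ge0 ?(adm_ge0 aG) ?(adm_ge0 aG').
- move=> v /=; apply: measurable_funD; apply: measurable_funM.
  + exact: measurable_cst.
  + exact: (adm_meas aG).
  + exact: measurable_cst.
  + exact: (adm_meas aG').
- by move=> w w' v h; rewrite (adm_env aG _ h) (adm_env aG' _ h).
- by move=> w v v' h; rewrite (adm_walk aG _ h) (adm_walk aG' _ h).
Qed.

Lemma adm_scale a (c : R) G : 0 <= c -> adm a G -> adm a (fun w v => c * G w v).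
Proof.
move=> c0 aG; split.
- by move=> w v; rewrite mulr_ge0 ?(adm_ge0 aG).
- by move=> v /=; apply: measurable_funM; [exact: measurable_cst|exact: (adm_meas aG)].
- by move=> w w' v h; rewrite (adm_env aG _ h).
- by move=> w v v' h; rewrite (adm_walk aG _ h).
Qed.

End admissible.

Section tilt.
Context (R : realType) (d : nat) (P : probability (env R d) R).
Hypotheses (iidP : iid_env P) (ellP : uniformly_elliptic P).
Variable theta : 'rV[R]_d.+1.
Implicit Types (w : env R d) (v : walk d).

Lemma dotD (u v v' : 'rV[R]_d.+1) : dot u (v + v') = dot u v + dot u v'.
Proof. by rewrite -big_split/=; apply: eq_bigr => i _; rewrite mxE mulrDr. Qed.

Lemma vecZD (z z' : 'rV[int]_d.+1) : vecZ R (z + z') = vecZ R z + vecZ R z'.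
Proof. by apply/rowP => i; rewrite !mxE rmorphD. Qed.

(** The density of the exponential change of measure up to time [a]; the [log_phi] term normalises
    its average to 1. *)
Definition tilt (a : nat) : env R d -> walk d -> R := fun _ v =>
  expR (dot theta (vecZ R (v a)) - a%:R * log_phi P theta).

Lemma adm_tilt a : adm a (tilt a).
Proof.
split => //.
- by move=> w v; exact: expR_ge0.
- by move=> w v v' h; rewrite /tilt h.
Qed.

Lemma tilt_cat a b w v : tilt (a + b) w v = catG a (tilt a) (tilt b) w v.
Proof.
rewrite /catG /tilt -expRD; congr expR.
have -> : v (a + b)%N = v a + tailw a v b by rewrite /tailw addrC subrK.
by rewrite vecZD dotD natrD; ring.
Qed.

Lemma integral_cst_prob (c : R) : (\int[P]_w c%:E = c%:E)%E.
Proof.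
by rewrite integral_cst// [X in (_ * X)%E](@probability_setT _ _ _ P) mule1.
Qed.

Lemma integral_trans z : (\int[P]_w (trans w 0 0 z)%:E = (mean_step P z)%:E)%E.
Proof.
rewrite /mean_step unlock fineK// ge0_fin_numE; last first.
  by apply: integral_ge0 => w _; rewrite lee_fin trans_ge0.
apply: (@le_lt_trans _ _ (\int[P]_w 1%:E)%E); last first.
  by rewrite integral_cst_prob ltry.
apply: ge0_le_integral => //.
- by move=> w _; rewrite lee_fin trans_ge0.
- by apply/measurable_EFinP; exact: measurable_trans.
- by move=> w _; rewrite lee_fin trans_le1.
Qed.

Lemma mean_step_ge0 z : 0 <= mean_step P z.
Proof.
rewrite -lee_fin -integral_trans; apply: integral_ge0 => w _.
by rewrite lee_fin trans_ge0.
Qed.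

Lemma phiE t : phi P t =
  \sum_(z <- nn_steps R d) mean_step P z * expR (dot t (vecZ R z)).
Proof.
rewrite /phi fsbig_finite/=; last exact: finite_unit_step.
by rewrite big_map.
Qed.

(** By ellipticity a single step already has mean weight at least [c]. *)
Lemma phi_gt0 t : 0 < phi P t.
Proof.
have [c c0 hc] := ellP.
pose z0 : unit_step R d := point.
have zU : step_val z0 \in nn_steps R d by rewrite mem_nn_steps; case: z0.
rewrite phiE (bigD1_seq (step_val z0)) ?uniq_nn_steps//=.
apply: (@lt_le_trans _ _ (c * expR (dot t (vecZ R (step_val z0))))).
  by rewrite mulr_gt0 ?expR_gt0.
rewrite -[leLHS]addr0 lerD//; last first.
  by apply: sumr_ge0 => z _; rewrite mulr_ge0 ?mean_step_ge0 ?expR_ge0.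
rewrite ler_wpM2r ?expR_ge0// -lee_fin -integral_trans.
set A := [set w : env R d | c <= trans w 0 0 (step_val z0)].
have mA : measurable A.
  have := @measurable_trans R d 0 0 (step_val z0) measurableT _ (measurable_itv `[c, +oo[).
  rewrite setTI; congr measurable; apply/seteqP; split => w /=;
  by rewrite in_itv/= andbT.
have h1 : (c%:E = \int[P]_(w in A) c%:E)%E by rewrite integral_cst// [X in (_ * X)%E]hc mule1.
have h2 : (\int[P]_(w in A) c%:E <= \int[P]_(w in A) (trans w 0 0 (step_val z0))%:E)%E.
  apply: ge0_le_integral => //.
  - by move=> w _; rewrite lee_fin ltW.
  - by apply/measurable_EFinP; apply: measurable_funS (measurable_trans _ _ _).
have h3 : (\int[P]_(w in A) (trans w 0 0 (step_val z0))%:E <=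
    \int[P]_w (trans w 0 0 (step_val z0))%:E)%E.
  apply: ge0_subset_integral => //.
  - by apply/measurable_EFinP; exact: measurable_trans.
  - by move=> w _; rewrite lee_fin trans_ge0.
by rewrite h1; exact: le_trans h2 h3.
Qed.

Lemma avg_tilt1 : avg P 1 (tilt 1) = 1%E.
Proof.
rewrite /avg /path_sum.
under eq_integral.
  move=> w _; rewrite big_allpairs_dep/= -sumEFin.
  under eq_bigr do rewrite big_seq1.
  over.
rewrite ge0_integral_sum//; last 2 first.
- move=> z; apply/measurable_EFinP.
  by apply: measurable_funM => //; exact: measurable_wt.
- by move=> z w _; rewrite lee_fin mulr_ge0 ?wt_ge0 ?expR_ge0.
transitivity (\sum_(z <- nn_steps R d)
    (mean_step P z * (expR (dot theta (vecZ R z)) / phi P theta))%:E)%E.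
  apply: eq_bigr => z _; rewrite EFinM -integral_trans -ge0_integralZr//; last 3 first.
  - by apply/measurable_EFinP; exact: measurable_trans.
  - by move=> w _; rewrite lee_fin trans_ge0.
  - by rewrite lee_fin divr_ge0 ?expR_ge0// ltW// phi_gt0.
  apply: eq_integral => w _; rewrite -EFinM /wt /tilt big_ord1/=.
  congr (_ * _)%:E; first by rewrite subr0 addr0.
  by rewrite addr0 mul1r expRD expRN /log_phi lnK// posrE phi_gt0.
rewrite sumEFin; congr EFin; under eq_bigr do rewrite mulrA.
by rewrite -mulr_suml -phiE divff// gt_eqF// phi_gt0.
Qed.

(** The tilt is multiplicative along concatenation, so [avg_cat] reduces the claim to one step,
    where dividing by [phi] is the normalisation. *)
Lemma avg_tilt a : avg P a (tilt a) = 1%E.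
Proof.
elim: a => [|a IH].
  rewrite /avg /path_sum; under eq_integral do rewrite big_seq1 /wt big_ord0 mul1r.
  rewrite [X in (\int[_]_w X w)%E](_ : _ = cst 1%E); last first.
    apply/funext => w; rewrite /tilt mul0r subr0; congr EFin.
    by rewrite (_ : dot _ _ = 0) ?expR0// /dot big1// => i _; rewrite !mxE mulr0.
  exact: integral_cst_prob.
rewrite (@avg_eq _ _ P a.+1 (1 + a) _ (catG 1 (tilt 1) (tilt a)))//.
  by rewrite avg_cat//; [rewrite avg_tilt1 IH mule1|exact: adm_tilt|exact: adm_tilt].
by move=> w v; rewrite -tilt_cat.
Qed.

End tilt.

(** * Local observables *)

Section local_observables.
Context (R : realType) (d : nat).
Implicit Types (w : env R d) (v : walk d).

(** The sets that cannot distinguish environments agreeing on [J] form a sigma-algebra containing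
    the generators. *)
Lemma sigma_coords_local (J : set (int * 'rV[int]_d.+1)) (A : set (env R d)) :
    <<s coord_sets measurable J (@site R d) >> A ->
  forall w w', (forall s, J s -> site s w = site s w') -> A w -> A w'.
Proof.
suff : <<s coord_sets measurable J (@site R d) >> `<=`
    [set A | forall w w', (forall s, J s -> site s w = site s w') -> A w -> A w'].
  by apply.
apply: smallest_sub => [|_ [s Js [B mB <-]] w w' /(_ _ Js) /= -> //].
split => //.
- move=> S hS w w' e [_ nS]; split => // Sw'; apply: nS; apply: hS Sw' => s Js.
  by rewrite e.
- by move=> S hS w w' e [i _ Si]; exists i => //; exact: hS Si.
Qed.

(** The hybrid [w''] follows [w] up to time [M] and [w'] afterwards. Measurability in the past
    passes from [w] to [w''], measurability in the future from [w''] to [w']. *)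
Lemma local_function_env N M K (f : env R d * steps R d -> R) w w' z :
    local_function N M K f ->
    (forall n y, - N%:Z <= n -> n <= M%:Z -> w n y = w' n y) ->
  f (w, z) = f (w', z).
Proof.
move=> [_ _ _ hf] e; have [hfut hpast] := hf z _ (measurable_set1 (f (w, z))).
pose w'' : env R d := fun n y => if n <= M%:Z then w n y else w' n y.
have h : f (w'', z) = f (w, z).
  by apply: (sigma_coords_local hpast (w := w)) => // s /= sM; rewrite /site /w'' sM.
symmetry; apply: (sigma_coords_local hfut (w := w'')) => // s /= sN.
by rewrite /site /w''; case: ifP => // sM; exact: e.
Qed.

Definition obs (f : env R d * steps R d -> R) (j : nat) w v : R :=
  f (Defs.shift j%:Z (v j) w, incr R v j).

Lemma obs_tail f a j w v :
  obs f j (Defs.shift a%:Z (v a) w) (tailw a v) = obs f (a + j) w v.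
Proof.
rewrite /obs; congr (f (_, _)).
  apply/funext => n; apply/funext => x; rewrite /Defs.shift /tailw.
  have -> : n + j%:Z + a%:Z = n + (a + j)%N%:Z by lia.
  by have -> : x + (v (a + j)%N - v a) + v a = x + v (a + j)%N by rewrite -addrA subrK.
apply/funext => i; rewrite /incr /tailw -addnS !addnA opprB addrA subrK.
by rewrite addnS.
Qed.

(** Observing at time [N] moves the environment window to the times 0 to [N + M] and involves
    positions up to time [N + K]; this is why a block has length [N + M + K + 1]. *)
Lemma adm_obs N M K f (h : R -> R) : local_function N M K f ->
    measurable_fun setT h -> (forall x, 0 <= h x) ->
  adm (N + M + K).+1 (fun w v => h (obs f N w v)).
Proof.
move=> fl mh h0; have [_ mf fK _] := fl; split => //.
- move=> v; apply: measurableT_comp => //.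
  apply: (measurableT_comp (measurable_fun_pair1 (incr R v N) mf)).
  exact: measurable_shift.
- move=> w w' v e; congr h; apply: local_function_env fl _ => n y nN nM.
  by rewrite /Defs.shift e//; lia.
- move=> w v v' e; congr h; rewrite /obs (e N); last by lia.
  by apply: fK => i iK; rewrite /incr !e//; lia.
Qed.

Lemma adm_mul a G G' : @adm R d a G -> adm a G' -> adm a (fun w v => G w v * G' w v).
Proof.
move=> aG aG'; split.
- by move=> w v; rewrite mulr_ge0 ?(adm_ge0 aG) ?(adm_ge0 aG').
- by move=> v /=; apply: measurable_funM; [exact: (adm_meas aG)|exact: (adm_meas aG')].
- by move=> w w' v h; rewrite (adm_env aG _ h) (adm_env aG' _ h).
- by move=> w v v' h; rewrite (adm_walk aG _ h) (adm_walk aG' _ h).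
Qed.

Lemma local_function_opp N M K f : @local_function R d N M K f ->
  local_function N M K (fun a => - f a).
Proof.
move=> [[C hC] mf fK fl]; split.
- by exists C => a; rewrite normrN.
- exact: measurableT_comp.
- by move=> w z z' /fK ->.
- move=> z B mB; apply: (fl z (-%R @^-1` B)).
  by rewrite -[X in measurable X]setTI; exact: oppr_measurable.
Qed.

Lemma local_function_addr N M K f c : @local_function R d N M K f ->
  local_function N M K (fun a => f a + c).
Proof.
move=> [[C hC] mf fK fl]; split.
- by exists (C + `|c|) => a; rewrite (le_trans (ler_normD _ _))// lerD.
- exact: measurable_funD.
- by move=> w z z' /fK ->.
- move=> z B mB; apply: (fl z ((fun x => x + c) @^-1` B)).
  rewrite -[X in measurable X]setTI.
  have : measurable_fun setT (fun x : R => x + c) by exact: measurable_funD.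
  exact.
Qed.

Lemma local_function_integrable (mu : probability (env R d * steps R d)%type R)
    N M K f : local_function N M K f -> mu.-integrable setT (EFin \o f).
Proof.
move=> [[C fC] mf _ _]; apply: measurable_bounded_integrable => //.
  by rewrite (le_lt_trans (@probability_le1 _ _ _ mu _ _))// ltry.
by exists C; split; [exact: num_real|move=> x Cx y _; exact: le_trans (fC y) (ltW Cx)].
Qed.

End local_observables.

(** * Path sums against the quenched laws, and the mean of an observable under mubar *)

Section mubar.
Context (R : realType) (d : nat) (P : probability (env R d) R).
Context (Q : env R d -> probability (walk d) R).
Hypothesis QE : forall w, quenched_law w 0 0 (Q w).
Implicit Types (w : env R d) (v : walk d).

Lemma measurable_coord i (z : 'rV[int]_d.+1) : measurable [set v : walk d | v i = z].
Proof. by apply: sub_sigma_algebra; exists i => //; exists [set z]. Qed.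

Lemma measurable_cyl a (u : walk d) : measurable (cyl a u).
Proof.
rewrite (_ : cyl a u = \bigcap_(i in [set i | (i <= a)%N]) [set v | v i = u i])//.
by apply: bigcap_measurable => [|i _]; [exists 0%N|exact: measurable_coord].
Qed.

Lemma quenched_cyl a w u : u 0%N = 0 -> Q w (cyl a u) = (wt a w u)%:E.
Proof.
by move=> u0; rewrite [LHS]QE u0 eqxx mul1r; congr EFin.
Qed.

Lemma paths_nn_walk a u v : u \in paths R a -> cyl a u v -> nn_walk R a v.
Proof.
move=> uP uv; split; first by rewrite uv// (paths_start uP).
by move=> i ia; rewrite !uv ?(ltnW ia)//; exact: paths_step uP ia.
Qed.

Lemma sum_indic_cyl_le1 a v : \sum_(u <- paths R a) \1_(cyl a u) v <= 1 :> R.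
Proof.
have [|h] := pselect (nn_walk R a v); first by move=> /sum_indic_cyl ->.
rewrite big1_seq// => u uP; rewrite indicE memNset// => uv; apply: h.
exact: paths_nn_walk uP uv.
Qed.

(* The kernel [Q] is not assumed measurable in the environment, so the integral
   of the larger function has to make sense without measurability. *)
Lemma ge0_le_integral_nomeas {dT} {T : measurableType dT} (mu : {measure set T -> \bar R})
    (g h : T -> \bar R) :
  (forall x, 0 <= g x)%E -> (forall x, g x <= h x)%E ->
  (\int[mu]_x g x <= \int[mu]_x h x)%E.
Proof.
move=> g0 gh; rewrite !ge0_integralTE//; last first.
  by move=> x; exact: le_trans (g0 x) (gh x).
by apply: ereal_sup_le => _ [s sg <-]; exists s => // x; exact: le_trans (sg x) (gh x).
Qed.

Lemma path_sum_integral a w (g : env R d -> walk d -> R) :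
    (forall v, 0 <= g w v) ->
  ((path_sum a g w)%:E =
   \int[Q w]_v (\sum_(u <- paths R a) (g w u * \1_(cyl a u) v)%:E))%E.
Proof.
move=> g0; rewrite ge0_integral_sum//; last 2 first.
- move=> u; apply/measurable_EFinP; apply: measurable_funM => //.
  by apply: measurable_indic; exact: measurable_cyl.
- by move=> u v _; rewrite lee_fin mulr_ge0.
rewrite -sumEFin; apply: eq_big_seq => u /paths_start u0.
under eq_integral do rewrite EFinM.
rewrite ge0_integralZl//; last 2 first.
- by apply/measurable_EFinP; apply: measurable_indic; exact: measurable_cyl.
- by rewrite lee_fin.
rewrite integral_indic//; last exact: measurable_cyl.
by rewrite setIT [X in (_ * X)%E]quenched_cyl// -EFinM mulrC.
Qed.

Lemma sum_cylE a w v (g : env R d -> walk d -> R) :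
    (forall v v', (forall i, (i <= a)%N -> v i = v' i) -> g w v = g w v') ->
  \sum_(u <- paths R a) g w u * \1_(cyl a u) v =
  g w v * \sum_(u <- paths R a) \1_(cyl a u) v.
Proof.
move=> ga; rewrite mulr_sumr; apply: eq_bigr => u _.
rewrite indicE; case: (boolP (v \in cyl a u)); last by rewrite !mulr0.
by rewrite inE => uv; congr (_ * _); apply: ga => i ia; rewrite uv.
Qed.

(** An inequality, because walks outside the enumerated cylinders contribute only to the right-hand
    side. *)
Lemma path_sum_le_quenched a w (g : env R d -> walk d -> R) :
    (forall v, 0 <= g w v) ->
    (forall v v', (forall i, (i <= a)%N -> v i = v' i) -> g w v = g w v') ->
  ((path_sum a g w)%:E <= \int[Q w]_v (g w v)%:E)%E.
Proof.
move=> g0 ga; rewrite path_sum_integral//.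
apply: ge0_le_integral_nomeas => v.
  by apply: sume_ge0 => u _; rewrite lee_fin mulr_ge0.
by rewrite sumEFin lee_fin (sum_cylE _ ga) ler_piMr// sum_indic_cyl_le1.
Qed.

Lemma avg_le_averaged a (g : env R d -> walk d -> R) : adm a g ->
  (avg P a g <= averaged_expectation P Q g)%E.
Proof.
move=> ag; apply: ge0_le_integral_nomeas => w.
  by rewrite lee_fin path_sum_ge0//; exact: adm_ge0 ag.
by apply: path_sum_le_quenched; [exact: (adm_ge0 ag)|move=> v v'; exact: (adm_walk ag)].
Qed.

Variables (theta : 'rV[R]_d.+1).
Context (mu : probability (env R d * steps R d)%type R).
Hypothesis muE : is_mubar P Q theta mu.

(* [obs f N w v + C] is nonnegative; the maximum only makes this syntactic, so
   that the integrand is admissible. *)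
Lemma avg_obs_le N M K (f : env R d * steps R d -> R) (C : R) :
    local_function N M K f -> (forall a, `|f a| <= C) ->
  (avg P (N + M + K).+1 (fun w v => tilt P theta (N + M + K).+1 w v * Num.max 0 (obs f N w v + C))%R <=
   (\int[mu]_a f a + C)%R%:E)%E.
Proof.
set m := (N + M + K).+1 => fl fC; have f0 a : 0 <= f a + C.
  by have := fC a; rewrite ler_norml => /andP[? _]; rewrite -lerBlDr sub0r.
apply: (@le_trans _ _ (averaged_expectation P Q
  (fun w v => tilt P theta m w v * (obs f N w v + C))%R)).
  have -> : (fun w v => tilt P theta m w v * (obs f N w v + C)) =
      (fun w v => tilt P theta m w v * Num.max 0 (obs f N w v + C)).
    by apply/funext => w; apply/funext => v; rewrite max_r// f0.
  apply: avg_le_averaged; apply: adm_mul; first exact: adm_tilt.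
  apply: (adm_obs (h := fun x => Num.max 0 (x + C)) fl).
    by apply: measurable_maxr => //; apply: measurable_funD.
  by move=> x; rewrite le_max lexx.
have := muE (local_function_addr C fl); rewrite /averaged_expectation /= => <-.
have intf := local_function_integrable mu fl.
under eq_integral do rewrite EFinD.
rewrite integralD//; last exact: finite_measure_integrable_cst.
rewrite integral_cst//= [X in (_ + _ * X)%E](@probability_setT _ _ _ mu) mule1 EFinD.
by rewrite /Rintegral fineK//; exact: integrable_fin_num.
Qed.

End mubar.

(** * Exponential moments over blocks *)

(** From [1 - x <= expR (- x)] one gets [expR x <= 1 / (1 - x)], and (1 - x)(1 + x + 2x^2) = 1 +
    x^2(1 - 2x) is at least 1 in the given range. *)
Lemma expR_le_quadratic (R : realType) (x : R) :
  x <= 1 / 2 -> expR x <= 1 + x + 2 * x ^+ 2.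
Proof.
move=> x2; have h : 1 - x <= expR (- x) by rewrite expR_ge1Dx.
have h1 : 0 < 1 - x by lra.
have h2 : expR x * (1 - x) <= 1.
  by rewrite -[leRHS](expRxMexpNx_1 x) ler_wpM2l ?expR_ge0.
rewrite -(ler_pM2r h1); apply: le_trans h2 _; nra.
Qed.

Section blocks.
Context (R : realType) (d : nat) (P : probability (env R d) R).
Hypotheses (iidP : iid_env P) (ellP : uniformly_elliptic P).
Context (Q : env R d -> probability (walk d) R).
Hypothesis QE : forall w, quenched_law w 0 0 (Q w).
Variable theta : 'rV[R]_d.+1.
Context (mu : probability (env R d * steps R d)%type R).
Hypothesis muE : is_mubar P Q theta mu.
Variables (N M K : nat) (f : env R d * steps R d -> R).
Hypothesis fl : local_function N M K f.
Implicit Types (w : env R d) (v : walk d).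

Let m := (N + M + K).+1.
Let c := \int[mu]_a f a.
Variables (C lam : R).
Hypotheses (fC : forall a, `|f a| <= C) (cC : `|c| <= C) (lam0 : 0 <= lam)
  (lamC : lam * (2 * C) <= 1 / 2).
Let tl := tilt P theta.

Definition block w v : R := tl m w v * expR (lam * (obs f N w v - c)).

Lemma adm_block : adm m block.
Proof.
apply: adm_mul; first exact: adm_tilt.
apply: (adm_obs (h := fun x => expR (lam * (x - c))) fl) => [|x]; last exact: expR_ge0.
apply: measurableT_comp; first exact: measurable_expR.
by apply: measurable_funM => //; exact: measurable_funB.
Qed.

Let rho := expR (2 * (lam * (2 * C)) ^+ 2).

(** The exponential is replaced by its quadratic bound, and the linear term is controlled by
    [avg_obs_le]. Adding [a] times the tilt to both sides turns that term into a multiple of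
    [f + C], which is nonnegative; after averaging, [a] cancels because [c] is the mean of [f]. *)
Lemma avg_block_le : (avg P m block <= rho%:E)%E.
Proof.
have C0 : 0 <= C by exact: le_trans (normr_ge0 _) cC.
have fc a : `|f a - c| <= 2 * C.
  by rewrite (le_trans (ler_normB _ _))//; have := fC a; move: cC; lra.
have cC0 : 0 <= c + C by move: cC; rewrite ler_norml => /andP[]; lra.
pose g w v := tl m w v * Num.max 0 (obs f N w v + C).
have ag : adm m g.
  apply: adm_mul; first exact: adm_tilt.
  apply: (adm_obs (h := fun x => Num.max 0 (x + C)) fl).
    by apply: measurable_maxr => //; apply: measurable_funD.
  by move=> x; rewrite le_max lexx.
have at_ := adm_tilt P theta m.
pose a := lam * (c + C); pose b := 1 + 2 * (lam * (2 * C)) ^+ 2.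
have a0 : 0 <= a by rewrite mulr_ge0.
have b0 : 0 <= b by rewrite addr_ge0// mulr_ge0// sqr_ge0.
have : (avg P m (fun w v => block w v + a * tl m w v)%R <=
    avg P m (fun w v => b * tl m w v + lam * g w v)%R)%E.
  apply: avg_le.
  - have := adm_comb (@ler01 R) a0 adm_block at_; congr adm.
    by apply/funext => w; apply/funext => v; rewrite mul1r.
  - exact: adm_comb.
  move=> w v; rewrite /g max_r; last first.
    by have := fC (Defs.shift N%:Z (v N) w, incr R v N); rewrite ler_norml => /andP[]; rewrite /obs; lra.
  rewrite /block; set t := tl m w v; set e := expR _.
  rewrite (_ : t * e + a * t = t * (e + a)); last by ring.
  rewrite (_ : b * t + _ = t * (b + lam * (obs f N w v + C))); last by ring.
  rewrite ler_wpM2l ?expR_ge0// /e.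
  set y := obs f N w v - c.
  have hy : `|y| <= 2 * C by exact: fc.
  have y1 : `|lam * y| <= lam * (2 * C) by rewrite normrM ger0_norm// ler_wpM2l.
  have := @expR_le_quadratic R (lam * y); have -> : lam * y <= 1/2.
    by rewrite (le_trans (ler_norm _))// (le_trans y1).
  move=> /(_ isT) h; rewrite -lerBrDr; apply: le_trans h _.
  have : (lam * y) ^+ 2 <= (lam * (2 * C)) ^+ 2.
    by rewrite -(real_normK (num_real (lam * y))) lerXn2r ?nnegrE ?mulr_ge0.
  have -> : obs f N w v = y + c by rewrite /y subrK.
  rewrite /a /b; lra.
rewrite avg_add//; [|exact: adm_block|exact: adm_scale].
rewrite avg_add//; [|exact: adm_scale|exact: adm_scale].
rewrite !avg_scale// avg_tilt// !mule1.
have := avg_obs_le QE muE fl fC; rewrite -/m -/(g _ _) => hg.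
have h3 : (lam%:E * avg P m g <= a%:E)%E by rewrite /a EFinM lee_wpmul2l ?lee_fin.
move=> /le_trans /(_ (leeD2l _ h3)); rewrite leeD2rE// => /le_trans; apply.
by rewrite lee_fin /b /rho expR_ge1Dx.
Qed.

Fixpoint blocks (k : nat) : env R d -> walk d -> R :=
  if k is k'.+1 then catG m block (blocks k') else tl 0.

Lemma adm_blocks k : adm (m * k) (blocks k).
Proof.
elim: k => [|k IH]; first by rewrite muln0; exact: adm_tilt.
by rewrite mulnS; apply: adm_cat => //; exact: adm_block.
Qed.

Lemma avg_blocks_le k : (avg P (m * k) (blocks k) <= (rho ^+ k)%:E)%E.
Proof.
elim: k => [|k IH]; first by rewrite muln0 expr0 avg_tilt.
rewrite mulnS avg_cat//; [|exact: adm_block|exact: adm_blocks].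
rewrite exprS EFinM; apply: lee_pmul => //; last exact: avg_block_le.
  by apply: avg_ge0 => //; exact: adm_ge0 adm_block.
by apply: avg_ge0 => //; exact: adm_ge0 (adm_blocks k).
Qed.

(** Recentring at the start of the i-th block turns its observable into the one at time [m * i + N],
    while the tilts of the blocks merge into one. *)
Lemma blocksE k w v : blocks k w v = tl (m * k) w v *
  expR (lam * \sum_(i < k) (obs f (m * i + N) w v - c)).
Proof.
elim: k w v => [|k IH] w v /=.
  by rewrite big_ord0 mulr0 expR0 mulr1 muln0.
rewrite /catG IH mulnS /tl tilt_cat /catG /block big_ord_recl muln0 add0n.
rewrite mulrACA; congr (_ * _).
rewrite -expRD -mulrDr; congr (expR (_ * (_ + _))).
by apply: eq_bigr => i _; rewrite obs_tail addnA -mulnS.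
Qed.

(* Only the observables at times in [r + m * nat + N] appear.  The tilt runs over
   the common horizon [m * k.+1], before and after the blocks as well, so that
   all residue classes can be summed. *)
Definition tilted_class (r k : nat) w v : R := tl (m * k.+1) w v *
  expR (lam * \sum_(i < k) (obs f (r + (m * i + N)) w v - c)).

(** Pure tilts of lengths [r] and [m - r] surround the blocks; each has average 1, so the padding
    does not change the bound. *)
Let padded_blocks r k := catG r (tl r) (catG (m * k) (blocks k) (tl (m - r))).

Let length_padded r k : (r <= m)%N -> (m * k.+1 = r + (m * k + (m - r)))%N.
Proof. by move=> rm; rewrite addnCA subnKC// mulnS addnC. Qed.

Let tilted_classE r k w v : (r <= m)%N ->
  tilted_class r k w v = padded_blocks r k w v.
Proof.
move=> rm; rewrite /tilted_class /padded_blocks (length_padded k rm) /tl !tilt_cat.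
rewrite /catG tilt_cat /catG blocksE -/tl -!mulrA; congr (_ * (_ * _)).
rewrite mulrC; congr (expR (_ * _) * _).
by apply: eq_bigr => i _; rewrite obs_tail.
Qed.

Lemma adm_tilted_class r k : (r <= m)%N -> adm (m * k.+1) (tilted_class r k).
Proof.
move=> rm; have -> : tilted_class r k = padded_blocks r k.
  by apply/funext => w; apply/funext => v; exact: tilted_classE.
rewrite (length_padded k rm); apply: adm_cat; first exact: adm_tilt.
by apply: adm_cat; [exact: adm_blocks|exact: adm_tilt].
Qed.

Lemma avg_tilted_class_le r k : (r <= m)%N ->
  (avg P (m * k.+1) (tilted_class r k) <= (rho ^+ k)%:E)%E.
Proof.
move=> rm; rewrite (avg_eq P (length_padded k rm) (fun w v => tilted_classE k w v rm)).
have ? := adm_tilt P theta; have ? := adm_blocks k.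
rewrite avg_cat//; last exact: adm_cat.
by rewrite avg_cat// /tl !avg_tilt// mul1e mule1 avg_blocks_le.
Qed.

End blocks.

(** * The averaged rate function and quenched bounds *)

Section legendre.
Context (R : realType) (d : nat) (P : probability (env R d) R).
Hypotheses (ellP : uniformly_elliptic P).
Implicit Types (t theta xi : 'rV[R]_d.+1).

Lemma is_derive_expsum (T : Type) (s : seq T) (a b : T -> R) :
  is_derive (0 : R) 1 (fun x => \sum_(z <- s) a z * expR (x * b z))
    (\sum_(z <- s) a z * b z).
Proof.
elim: s => [|z s IH].
  rewrite big_nil (_ : (fun _ => _) = cst 0); first exact: is_derive_cst.
  by apply/funext => x; rewrite big_nil.
rewrite big_cons (_ : (fun _ => _) = (fun x => a z * expR (x * b z)) \+
    (fun x => \sum_(z <- s) a z * expR (x * b z))); last first.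
  by apply/funext => x; rewrite big_cons.
apply: is_deriveD.
have h1 : is_derive (0 : R) 1 (fun x : R => x * b z) (b z).
  have := @is_deriveM R _ id (cst (b z)) 0 1 1 0 (is_derive_id _ _) (is_derive_cst _ _ _).
  by rewrite /= scaler0 add0r scaler1 => h; exact: h.
have h2 : is_derive ((0 : R) * b z) 1 expR (expR (0 * b z)).
  exact: is_derive_expR.
have h3 := @is_derive1_comp R expR (fun x => x * b z) 0 _ _ h2 h1.
have : is_derive (0 : R) 1 (a z \*: (expR \o (fun x => x * b z)))
    (a z *: (expR (0 * b z) * b z)) by exact: is_deriveZ.
by rewrite mul0r expR0 mul1r.
Qed.

Lemma derive_line (g : 'rV[R]_d.+1 -> R) t v :
  'D_v g t = 'D_1 (fun x : R => g (x *: v + t)) 0.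
Proof.
have e : (fun h : R => h^-1 *: ((g \o shift t) (h *: v) - g t)) =
    (fun h => h^-1 *: (((fun x => g (x *: v + t)) \o shift 0) (h *: 1) -
      g ((0 : R) *: v + t))).
  by apply/funext => h /=; rewrite [h *: 1]mulr1 addr0 scale0r add0r.
by rewrite /derive e.
Qed.

Definition tilted_weight theta (z : 'rV[int]_d.+1) : R :=
  mean_step P z * expR (dot theta (vecZ R z)).

(** The gradient is the mean of the tilted step law. Along a coordinate line [phi] is a finite sum
    of exponentials in one real variable, which gives each partial derivative. *)
Lemma gradient_log_phi theta :
  gradient (log_phi P) theta =
  (phi P theta)^-1 *: \sum_(z <- nn_steps R d) tilted_weight theta z *: vecZ R z.
Proof.
apply/rowP => i; rewrite !mxE derive_line.
have e x : log_phi P (x *: delta_mx 0 i + theta) =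
    ln (\sum_(z <- nn_steps R d) tilted_weight theta z * expR (x * vecZ R z 0 i)).
  rewrite /log_phi phiE; congr ln; apply: eq_bigr => z _; rewrite /tilted_weight -mulrA -expRD.
  congr (_ * expR _); rewrite addrC {1}/dot (eq_bigr (fun j =>
    theta 0 j * vecZ R z 0 j + x * (delta_mx 0 i : 'rV[R]_d.+1) 0 j * vecZ R z 0 j)); last first.
    by move=> j _; rewrite !mxE; ring.
  rewrite big_split/=; congr (_ + _); rewrite (bigD1 i)//= big1 => [|j ji].
    by rewrite !mxE !eqxx mulr1 addr0.
  by rewrite !mxE (negbTE ji) andbF mulr0 mul0r.
have -> : (fun x => log_phi P (x *: delta_mx 0 i + theta)) =
  @ln R \o (fun x => \sum_(z <- nn_steps R d) tilted_weight theta z * expR (x * vecZ R z 0 i)).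
  by apply/funext => x; exact: e.
have e0 : \sum_(z <- nn_steps R d) tilted_weight theta z * expR (0 * vecZ R z 0 i) = phi P theta.
  by rewrite phiE; apply: eq_bigr => z _; rewrite mul0r expR0 mulr1.
have h1 := is_derive_expsum (nn_steps R d) (tilted_weight theta) (fun z => vecZ R z 0 i).
have h2 : is_derive (\sum_(z <- nn_steps R d) tilted_weight theta z * expR (0 * vecZ R z 0 i)) 1
    (@ln R) (phi P theta)^-1.
  by rewrite e0; apply: is_derive1_ln; exact: phi_gt0.
have h3 := @is_derive1_comp R (@ln R) _ 0 _ _ h2 h1.
rewrite (@derive_val _ _ _ _ _ _ _ h3); congr (_ * _).
by rewrite summxE; apply: eq_bigr => z _; rewrite !mxE.
Qed.

Lemma dotZr t (a : R) u : dot t (a *: u) = a * dot t u.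
Proof. by rewrite /dot mulr_sumr; apply: eq_bigr => i _; rewrite mxE mulrCA. Qed.

Lemma dotDl t t' u : dot (t + t') u = dot t u + dot t' u.
Proof. by rewrite -big_split/=; apply: eq_bigr => i _; rewrite mxE mulrDl. Qed.

Lemma dot_sumr t (T : Type) (s : seq T) (F : T -> 'rV[R]_d.+1) :
  dot t (\sum_(z <- s) F z) = \sum_(z <- s) dot t (F z).
Proof.
elim: s => [|z s IH]; last by rewrite !big_cons dotD IH.
by rewrite !big_nil /dot big1// => i _; rewrite mxE mulr0.
Qed.

Lemma I_a_le theta xi : xi = gradient (log_phi P) theta ->
  (I_a P xi <= (dot theta xi - log_phi P theta)%:E)%E.
Proof.
move=> xiE; apply: ge_ereal_sup => _ [t _ <-]; rewrite lee_fin.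
pose F := phi P theta; have F0 : 0 < F by exact: phi_gt0.
pose m := dot (t - theta) xi.
have W0 z : 0 <= tilted_weight theta z by rewrite mulr_ge0 ?mean_step_ge0 ?expR_ge0.
have WE : \sum_(z <- nn_steps R d) tilted_weight theta z = F by rewrite /F phiE.
have mE : \sum_(z <- nn_steps R d) tilted_weight theta z * dot (t - theta) (vecZ R z) = F * m.
  rewrite /m xiE gradient_log_phi dotZr mulrA divff ?gt_eqF// mul1r dot_sumr.
  by apply: eq_bigr => z _; rewrite dotZr.
(* Jensen for the tilted step law, via [e^x >= e^m (1 + x - m)] *)
have h : F * expR m <= phi P t.
  have -> : phi P t = \sum_(z <- nn_steps R d) tilted_weight theta z * expR (dot (t - theta) (vecZ R z)).
    rewrite phiE; apply: eq_bigr => z _.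
    by rewrite /tilted_weight -mulrA -expRD -dotDl addrC subrK.
  apply: (@le_trans _ _ (\sum_(z <- nn_steps R d)
      tilted_weight theta z * (expR m * (1 + (dot (t - theta) (vecZ R z) - m))))).
    rewrite (eq_bigr (fun z => expR m * (1 - m) * tilted_weight theta z +
      expR m * (tilted_weight theta z * dot (t - theta) (vecZ R z)))); last first.
      by move=> z _; ring.
    rewrite big_split/= -!mulr_sumr WE mE le_eqVlt; apply/orP; left; apply/eqP; ring.
  apply: ler_sum => z _; rewrite ler_wpM2l//.
  have -> : expR (dot (t - theta) (vecZ R z)) = expR m * expR (dot (t - theta) (vecZ R z) - m).
    by rewrite -expRD [m + _]addrC subrK.
  by rewrite ler_wpM2l ?expR_ge0// expR_ge1Dx.
have hl : log_phi P theta + m <= log_phi P t.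
  rewrite /log_phi -[X in _ + X]expRK -lnM ?posrE ?expR_gt0// ler_ln ?posrE//.
    by rewrite mulr_gt0// expR_gt0.
  exact: phi_gt0.
have -> : dot t xi = dot theta xi + m by rewrite -dotDl addrC subrK.
by move: hl; lra.
Qed.

End legendre.

(** * Almost sure nearest-neighbour walks and quenched probabilities bounded by path sums *)

Section quenched.
Context (R : realType) (d : nat) (P : probability (env R d) R).
Hypotheses (iidP : iid_env P) (nnP : nearest_neighbor P).
Context (Q : env R d -> probability (walk d) R).
Hypothesis QE : forall w, quenched_law w 0 0 (Q w).
Implicit Types (w : env R d) (v : walk d).

Definition walk_of_seq (s : seq 'rV[int]_d.+1) : walk d := fun i => nth 0 s i.

(** An event determined by the positions up to time [a] is a union of cylinders, indexed by natural
    numbers through the coding of finite sequences. *)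
Definition local_cyl a (S : set (walk d)) (n : nat) : set (walk d) :=
  if unpickle n is Some s then
    if `[< S (walk_of_seq s) >] then cyl a (walk_of_seq s) else set0
  else set0.

Lemma local_bigcup a (S : set (walk d)) :
    (forall v v', (forall i, (i <= a)%N -> v i = v' i) -> S v -> S v') ->
  S = \bigcup_n local_cyl a S n.
Proof.
move=> Sa; apply/seteqP; split => v.
  move=> Sv; exists (pickle (mkseq v a.+1)) => //; rewrite /local_cyl pickleK.
  have e i : (i <= a)%N -> v i = walk_of_seq (mkseq v a.+1) i.
    by move=> ia; rewrite /walk_of_seq nth_mkseq.
  by case: asboolP => // nS; exfalso; apply: nS; exact: Sa Sv.
move=> [n _]; rewrite /local_cyl; case: (unpickle n) => // s; case: asboolP => // Ss vs.
by apply: Sa Ss => i ia; rewrite vs.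
Qed.

Lemma measurable_local a (S : set (walk d)) :
    (forall v v', (forall i, (i <= a)%N -> v i = v' i) -> S v -> S v') ->
  measurable S.
Proof.
move=> /local_bigcup ->; apply: bigcupT_measurable => n.
rewrite /local_cyl; case: (unpickle n) => [s|]; last exact: measurable0.
by case: ifP => // _; exact: measurable_cyl.
Qed.

Definition nn_env w := forall n x z, z \notin nn_steps R d -> trans w n x z = 0.

(** The assumption concerns the site at the origin only; [iid_env] carries it to every site, and
    countably many null sets are discarded. *)
Lemma ae_nn_env : {ae P, forall w, nn_env w}.
Proof.
pose A k w : Prop := if unpickle k is Some (n, x, z) then
  z \notin nn_steps R d -> trans w n x z = 0 else True.
have : {ae P, forall w, forall k, A k w}.
  apply: ae_foralln => k; rewrite /A; case: (unpickle k) => [[[n x] z]|]; last exact: aeW.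
  have [zU|zU] := boolP (z \in nn_steps R d); first exact: aeW.
  pose B := [set p : prob_vector R d | 0 < p z].
  have mB : measurable B.
    have := @measurable_pv R d z measurableT _ (measurable_itv `]0, +oo[).
    rewrite setTI; congr measurable; apply/seteqP; split => p /=;
    by rewrite in_itv/= andbT.
  exists [set w | B (site (n, x) w)]; split.
  - by rewrite -[X in measurable X]setTI; exact: (measurable_site (n, x) measurableT mB).
  - have := iidP (r := [:: (n, x)]) (B := fun=> B) isT (fun=> mB).
    rewrite big_seq1 => h; rewrite [RHS](_ : _ = P [set w | 0 < trans w 0 0 z]); last first.
      rewrite [RHS]nnP//; apply/eqP; apply: contra zU => /eqP e.
      by rewrite mem_nn_steps e.
    rewrite -[RHS]h; congr (P _); apply/seteqP; split => w /=.
      by move=> ? s; rewrite inE => /eqP ->.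
    by apply; rewrite inE.
  - move=> w /= h; rewrite /B/= /site/= lt_neqAle trans_ge0 andbT eq_sym.
    by apply/eqP => e; apply: h.
apply: filterS => w h n x z zU.
by have := h (pickle (n, x, z)); rewrite /A pickleK; exact.
Qed.

(** The exceptional event is a countable union of cylinders; each is null, having either a wrong
    starting point or a forbidden step that makes one factor vanish. *)
Lemma quenched_nn_walk w a : nn_env w -> Q w (~` nn_walk R a) = 0%E.
Proof.
move=> nw.
have Sa v v' : (forall i, (i <= a)%N -> v i = v' i) -> (~` nn_walk R a) v -> (~` nn_walk R a) v'.
  move=> e h [v'0 hv']; apply: h; split; first by rewrite e.
  by move=> i ia; rewrite !e// ?(ltnW ia)//; exact: hv'.
apply: measure_negligible; first exact: measurable_local Sa.
rewrite (local_bigcup Sa); apply: negligible_bigcup => n; rewrite /local_cyl.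
case: (unpickle n) => [s|]; last exact: negligible_set0.
case: asboolP => [h|_]; last exact: negligible_set0.
exists (cyl a (walk_of_seq s)); split => //; first exact: measurable_cyl.
rewrite [LHS]QE; have [u0|] := eqVneq; last by rewrite mul0r.
have [i ia hi] : exists2 i, (i < a)%N &
    walk_of_seq s i.+1 - walk_of_seq s i \notin nn_steps R d.
  apply: contrapT => hn; apply: h; split => // i ia.
  by apply: contrapT => /negP hi; apply: hn; exists i.
by rewrite mul1r (bigD1 (Ordinal ia))//= nw// mul0r.
Qed.

(** Markov's inequality in path-sum form. It holds for nearest-neighbour environments because there
    the enumerated cylinders carry all the mass. *)
Lemma quenched_le_path_sum a w (G : env R d -> walk d -> R) (S : set (walk d)) :
    nn_env w -> (forall v, 0 <= G w v) ->
    (forall v v', (forall i, (i <= a)%N -> v i = v' i) -> G w v = G w v') ->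
    (forall v v', (forall i, (i <= a)%N -> v i = v' i) -> S v -> S v') ->
    (forall v, S v -> nn_walk R a v -> 1 <= G w v) ->
  (Q w S <= (path_sum a G w)%:E)%E.
Proof.
move=> nw G0 Ga Sa SG; have mS := measurable_local Sa.
have Na v v' : (forall i, (i <= a)%N -> v i = v' i) -> nn_walk R a v -> nn_walk R a v'.
  move=> e [v0 hv]; split; first by rewrite -e.
  by move=> i ia; rewrite -(e _ ia) -(e _ (ltnW ia)); exact: hv.
have mN : measurable (nn_walk R a : set (walk d)) by exact: measurable_local Na.
have -> : Q w S = Q w (S `&` nn_walk R a).
  rewrite -[in LHS](setIT S) -(setUv (nn_walk R a)) setIUr measureU//; last 3 first.
  - exact: measurableI.
  - by apply: measurableI => //; exact: measurableC.
  - by rewrite setIACA setICr setI0.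
  rewrite [X in (_ + X)%E](_ : _ = 0%E) ?adde0//; apply/eqP; rewrite eq_le measure_ge0 andbT.
  rewrite -(quenched_nn_walk a nw); apply: le_measure; rewrite ?inE//.
  - by apply: measurableI => //; exact: measurableC.
  - exact: measurableC.
rewrite (path_sum_integral QE)//.
have -> : Q w (S `&` nn_walk R a) = (\int[Q w]_v (\1_(S `&` nn_walk R a) v)%:E)%E.
  by rewrite integral_indic ?setIT//; exact: measurableI.
apply: ge0_le_integral_nomeas => v; first by rewrite lee_fin.
rewrite sumEFin lee_fin (sum_cylE _ Ga) indicE.
case: (boolP (v \in _)) => [|_].
  by rewrite inE => -[Sv nv]; rewrite sum_indic_cyl// mulr1 SG.
by rewrite mulr_ge0// sumr_ge0.
Qed.

End quenched.

(** * Deviations of the ergodic averages *)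

Section deviations.
Context (R : realType).

Lemma sum_residues m k (g : nat -> R) :
  \sum_(l < m * k) g l = \sum_(r < m) \sum_(i < k) g (r + m * i)%N.
Proof.
elim: k => [|k IH].
  by rewrite muln0 big_ord0 big1// => r _; rewrite big_ord0.
rewrite mulnSr big_split_ord/= IH.
under [RHS]eq_bigr do rewrite big_ord_recr/=.
by rewrite big_split/=; congr (_ + _); apply: eq_bigr => r _; rewrite addnC.
Qed.

Lemma sum_bound (s : R) a n (g : nat -> R) : (forall j, `|g j| <= s) ->
  `|\sum_(i < n) g (a + i)%N| <= s *+ n.
Proof.
move=> gs; apply: le_trans (ler_norm_sum _ _ _) _.
by rewrite -[X in _ *+ X]card_ord -sumr_const; apply: ler_sum => i _; exact: gs.
Qed.

(** The windows from 0 to [n] and from [N] to [N + m * k] differ by [N] terms at the start and at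
    most [N + m] at the end. *)
Lemma sum_window (s : R) N m k n (g : nat -> R) : (forall j, `|g j| <= s) ->
    (n <= m * k)%N -> (m * k <= n + m)%N ->
  \sum_(j < n) g j - s * (2 * N + m)%:R <= \sum_(l < m * k) g (N + l)%N.
Proof.
move=> gs nk kn; have s0 : 0 <= s by exact: le_trans (normr_ge0 _) (gs 0%N).
have sumD a b : \sum_(j < a + b) g j = \sum_(j < a) g j + \sum_(l < b) g (a + l)%N.
  by rewrite big_split_ord.
have e1 := sumD N (m * k)%N.
have e2 : \sum_(j < N + m * k) g j =
    \sum_(j < n) g j + \sum_(l < N + m * k - n) g (n + l)%N.
  by rewrite -sumD subnKC//; lia.
have : `|\sum_(j < N) g j| <= s *+ N := sum_bound 0 N gs.
have := sum_bound n (N + m * k - n) gs.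
set t := \sum_(l < _ - n) _; set u := \sum_(j < N) _.
rewrite !ler_norml => /andP[h1 _] /andP[_ h2].
have h3 : s *+ (N + m * k - n) + s *+ N <= s * (2 * N + m)%:R.
  by rewrite -mulrnDr -[leLHS]mulr_natr ler_wpM2l// ler_nat; lia.
by move: e1 e2 h1 h2 h3; rewrite -/t -/u; lra.
Qed.

(* Pigeonhole over the residue classes modulo [m]. *)
Lemma exceed_residue (s lam : R) N m k n e (g : nat -> R) :
    (0 < m)%N -> (forall j, `|g j| <= s) -> (n <= m * k)%N -> (m * k <= n + m)%N ->
    0 <= lam -> e < \sum_(j < n) g j ->
  1 <= \sum_(r < m) expR (lam * (\sum_(i < k) g (r + (m * i + N))%N -
    (e - s * (2 * N + m)%:R) / m%:R)).
Proof.
move=> m0 gs nk kn lam0 eg; set B := (e - _) / _.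
have [[r hr]|h] := pselect (exists r : 'I_m, B < \sum_(i < k) g (r + (m * i + N))%N).
  rewrite (bigD1 r)//= -[leLHS]addr0 lerD//; last first.
    by apply: sumr_ge0 => i _; exact: expR_ge0.
  by rewrite -expR0 ler_expR mulr_ge0// subr_ge0 ltW.
(* If no class exceeds [B], the sum over all classes is at most [m * B], which contradicts
   [sum_window]. *)
have : \sum_(r < m) \sum_(i < k) g (r + (m * i + N))%N <= \sum_(r < m) B.
  by apply: ler_sum => r _; rewrite leNgt; apply/negP => hr; apply: h; exists r.
rewrite sumr_const card_ord -mulr_natr /B mulfVK ?pnatr_eq0 -?lt0n//.
have := sum_window N gs nk kn; rewrite (sum_residues m k (fun l => g (N + l)%N)).
rewrite (eq_bigr (fun r : 'I_m => \sum_(i < k) g (r + (m * i + N))%N)); last first.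
  by move=> r _; apply: eq_bigr => i _; rewrite addnC -addnA.
by move: eg; lra.
Qed.

End deviations.

(** * The tilt on the conditioning event *)

Section tilt_bound.
Context (R : realType) (d : nat) (P : probability (env R d) R).
Variables (theta : 'rV[R]_d.+1).
Implicit Types (v : walk d).

Definition norm1 : R := \sum_i `|theta 0 i|.

Lemma norm1_ge0 : 0 <= norm1.
Proof. by apply: sumr_ge0 => i _. Qed.

Lemma coord_le_enorm (x : 'rV[R]_d.+1) i : `|x 0 i| <= enorm x.
Proof.
rewrite -sqrtr_sqr /enorm ler_wsqrtr// /dot (bigD1 i)//= expr2 lerDl.
by apply: sumr_ge0 => j _; rewrite -expr2 sqr_ge0.
Qed.

Lemma dot_le_norm1 (x : 'rV[R]_d.+1) : `|dot theta x| <= norm1 * enorm x.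
Proof.
rewrite /dot; apply: le_trans (ler_norm_sum _ _ _) _.
rewrite /norm1 mulr_suml; apply: ler_sum => i _.
by rewrite normrM ler_wpM2l// coord_le_enorm.
Qed.

Lemma nn_walk_dot H v n j : nn_walk R H v -> (n + j <= H)%N ->
  `|dot theta (vecZ R (v (n + j)%N)) - dot theta (vecZ R (v n))| <= j%:R * norm1.
Proof.
move=> [_ nv]; elim: j => [|j IH] h; first by rewrite addn0 subrr normr0 mul0r.
have h' : (n + j < H)%N by rewrite addnS in h.
rewrite addnS -natr1 mulrDl mul1r.
have -> : v (n + j).+1 = (v (n + j).+1 - v (n + j)%N) + v (n + j)%N by rewrite subrK.
rewrite vecZD dotD -addrA addrC (le_trans (ler_normD _ _))// lerD ?IH ?(ltnW h')//.
have := nv _ h'; rewrite mem_nn_steps => /eqP e.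
by have := dot_le_norm1 (vecZ R (v (n + j).+1 - v (n + j)%N)); rewrite e mulr1.
Qed.

(** The distance of the mean velocity from [xi] costs at most [n * delta * norm1]. Since the tilt is
    taken at the horizon [H], the at most [h] steps after time [n] cost a further bounded amount. *)
Lemma tilt_lower_bound xi delta H (h : nat) n w v : (0 < n)%N -> (n <= H)%N -> (H <= n + h)%N ->
    nn_walk R H v -> event_D xi delta n v ->
  expR (n%:R * (dot theta xi - log_phi P theta) - n%:R * (delta * norm1) -
     h%:R * (norm1 + `|log_phi P theta|)) <= tilt P theta H w v.
Proof.
move=> n0 nH Hh nv dv; rewrite /tilt ler_expR.
set L := log_phi P theta.
have n0' : 0 < n%:R :> R by rewrite ltr0n.
have nd := norm1_ge0.
have := nn_walk_dot (n := n) (j := H - n) nv; rewrite subnKC// => /(_ (leqnn _)).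
rewrite ler_norml => /andP[h1 _].
have Hn : (H - n)%:R <= h%:R :> R by rewrite ler_nat; lia.
have HE : H%:R = n%:R + (H - n)%:R :> R by rewrite -natrD subnKC.
have h2 : (H - n)%:R * L <= h%:R * `|L|.
  apply: (@le_trans _ _ ((H - n)%:R * `|L|)); first by rewrite ler_wpM2l// ler_norm.
  by rewrite ler_wpM2r.
have h3 : (H - n)%:R * norm1 <= h%:R * norm1 by rewrite ler_wpM2r.
have h4 : `|dot theta (mean_velocity R n v - xi)| <= norm1 * delta.
  by apply: le_trans (dot_le_norm1 _) _; rewrite ler_wpM2l.
have h5 : dot theta (vecZ R (v n)) = n%:R * dot theta xi + n%:R * dot theta (mean_velocity R n v - xi).
  rewrite -mulrDr -dotD addrC subrK /mean_velocity dotZr mulrA divff ?mul1r//.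
  by rewrite gt_eqF.
have h6 : - (n%:R * (norm1 * delta)) <= n%:R * dot theta (mean_velocity R n v - xi).
  rewrite -mulrN ler_wpM2l//.
  by move: h4; rewrite ler_norml => /andP[].
rewrite HE mulrDl mulrBr; move: h1 h2 h3 h5 h6.
rewrite (mulrC delta); lra.
Qed.

End tilt_bound.

(** * A path-sum majorant for the joint event *)

Section upper_bound.
Context (R : realType) (d : nat) (P : probability (env R d) R).
Hypotheses (iidP : iid_env P) (ellP : uniformly_elliptic P).
Context (Q : env R d -> probability (walk d) R).
Hypothesis QE : forall w, quenched_law w 0 0 (Q w).
Variables (theta xi : 'rV[R]_d.+1).
Context (mu : probability (env R d * steps R d)%type R).
Hypothesis muE : is_mubar P Q theta mu.
Variables (N M K : nat) (f : env R d * steps R d -> R).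
Hypothesis fl : local_function N M K f.
Implicit Types (w : env R d) (v : walk d).

Let m := (N + M + K).+1.
Let c := \int[mu]_a f a.
Variables (C lam eps delta : R).
Hypotheses (fC : forall a, `|f a| <= C) (cC : `|c| <= C) (lam0 : 0 <= lam)
  (lamC : lam * (2 * C) <= 1 / 2).

Lemma integral_opp : \int[mu]_a (- f a) = - c.
Proof.
have intf := local_function_integrable mu fl.
rewrite -[RHS]mulN1r -RintegralZl//.
by apply: eq_Rintegral => a _; rewrite mulN1r.
Qed.

Let blocks_needed n := (n %/ m).+1.

Let opp_fl : local_function N M K (fun a => - f a) := local_function_opp fl.

(** The terms for [f] and for its opposite handle the two signs of the deviation. *)
Definition residue_sum k : env R d -> walk d -> R := fun w v => \sum_(r < m)
  (tilted_class P theta mu N M K f lam r k w v +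
   tilted_class P theta mu N M K (fun a => - f a) lam r k w v).

(** One period beyond the blocks leaves room for the shift by a residue; the horizon then lies
    between [n + m] and [n + 2 * m]. *)
Let horizon n := (m * (blocks_needed n).+1)%N.

(* On [event_D], [expR (n * (dot theta xi - log_phi P theta) - ...)] bounds the
   tilt from below; the last term is the Chernoff threshold of one class. *)
Definition rate_bound (n : nat) : R :=
  expR (- (n%:R * (dot theta xi - log_phi P theta) - n%:R * (delta * norm1 theta) -
     (2 * m)%:R * (norm1 theta + `|log_phi P theta|)) -
     lam * ((n%:R * eps - (2 * C) * (2 * N + m)%:R) / m%:R)).

Definition majorant (n : nat) : env R d -> walk d -> R := fun w v =>
  rate_bound n * residue_sum (blocks_needed n) w v.

Lemma n_le_blocks n : (n <= m * blocks_needed n)%N.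
Proof. by rewrite ltnW// mulnC ltn_ceil. Qed.

Lemma blocks_le_n n : (m * blocks_needed n <= n + m)%N.
Proof. by rewrite /blocks_needed mulnS addnC leq_add2r mulnC leq_divM. Qed.

Lemma exceed_tilted (g : env R d * steps R d -> R) n w v : (0 < n)%N ->
    (forall a, `|g a - \int[mu]_a g a| <= 2 * C) ->
    nn_walk R (horizon n) v -> event_D xi delta n v ->
    n%:R * eps < \sum_(j < n) (obs g j w v - \int[mu]_a g a) ->
  1 <= rate_bound n *
    \sum_(r < m) tilted_class P theta mu N M K g lam r (blocks_needed n) w v.
Proof.
move=> n0 gC nv dv eg.
have := @exceed_residue _ _ _ N m _ n _ (fun j => obs g j w v - \int[mu]_a g a) isT
  (fun j => gC (Defs.shift j%:Z (v j) w, incr R v j)) (n_le_blocks n) (blocks_le_n n) lam0 eg.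
have := @tilt_lower_bound _ _ P theta xi delta (horizon n) (2 * m) n w v n0.
have -> : (n <= horizon n)%N by rewrite /horizon mulnS; have := n_le_blocks n; lia.
have -> : (horizon n <= n + 2 * m)%N by rewrite /horizon mulnS; have := blocks_le_n n; lia.
move=> /(_ isT isT nv dv); set E0 := (_ - _ - _) => ht h1.
rewrite /rate_bound -/E0; set B := (_ / m%:R) in h1 *.
apply: le_trans h1 _; rewrite mulr_sumr; apply: ler_sum => r _.
set S := \sum_(i < _) _; rewrite /tilted_class -/S.
(* The exponent is split so that the factor [expR E0] can be replaced by the tilt, which dominates
   it on [event_D]. *)
rewrite (_ : lam * (S - B) = (- E0 - lam * B) + (E0 + lam * S)); last by ring.
rewrite expRD ler_wpM2l ?expR_ge0// expRD ler_wpM2r ?expR_ge0//.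
Qed.

Lemma majorant_ge1 n w v : (0 < n)%N -> nn_walk R (horizon n) v ->
    event_A mu f eps w n v -> event_D xi delta n v ->
  1 <= majorant n w v.
Proof.
move=> n0 nv av dv.
have n0' : 0 < n%:R :> R by rewrite ltr0n.
have fc a : `|f a - c| <= 2 * C.
  by rewrite (le_trans (ler_normB _ _))//; have := fC a; move: cC; lra.
have fc' a : `|- f a - \int[mu]_a (- f a)| <= 2 * C.
  by rewrite integral_opp -opprD normrN.
have T0 g r k : 0 <= tilted_class P theta mu N M K g lam r k w v.
  by rewrite mulr_ge0 ?expR_ge0.
rewrite /majorant /residue_sum big_split/= mulrDr.
have S0 g k : 0 <= rate_bound n * \sum_(r < m) tilted_class P theta mu N M K g lam r k w v.
  by rewrite mulr_ge0 ?expR_ge0// sumr_ge0.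
have : n%:R * eps < `|\sum_(j < n) (obs f j w v - c)|.
  rewrite sumrB sumr_const card_ord -[c *+ n]mulr_natl.
  move: av; rewrite /event_A/= big_mkord -/c => av.
  rewrite -ltr_pdivlMl// -[X in X * `|_|]ger0_norm ?invr_ge0 ?ltW//.
  by rewrite -normrM mulrBr mulKf ?gt_eqF.
(* The sign of the deviation selects one of the two halves of the majorant; the other half is
   nonnegative. *)
case: (lerP 0 (\sum_(j < n) (obs f j w v - c))) => h.
  rewrite ger0_norm// => eg; have h1 := exceed_tilted n0 fc nv dv eg.
  by apply: (le_trans h1); rewrite lerDl; exact: S0.
rewrite ltr0_norm// => eg.
have eg' : n%:R * eps < \sum_(j < n) (obs (fun a => - f a) j w v - \int[mu]_a (- f a)).
  rewrite integral_opp; apply: lt_le_trans eg _; rewrite -sumrN le_eqVlt; apply/orP; left.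
  by apply/eqP; apply: eq_bigr => j _; rewrite opprD.
have h1 := exceed_tilted n0 fc' nv dv eg'.
by apply: (le_trans h1); rewrite lerDr; exact: S0.
Qed.

Lemma adm_sum a n (G : nat -> env R d -> walk d -> R) (b : \bar R) :
    (0 <= b)%E -> (forall r, (r < n)%N -> adm a (G r)) ->
    (forall r, (r < n)%N -> (avg P a (G r) <= b)%E) ->
  adm a (fun w v => \sum_(r < n) G r w v) /\
  (avg P a (fun w v => \sum_(r < n) G r w v)%R <= n%:R%:E * b)%E.
Proof.
move=> b0; elim: n => [|n IH] aG hG.
  have -> : (fun (w : env R d) (v : walk d) => \sum_(r < 0) G r w v) = fun _ _ => 0.
    by apply/funext => w; apply/funext => v; rewrite big_ord0.
  split; first by split.
  rewrite mul0e /avg integral0_eq// => w _.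
  by rewrite /path_sum big1// => u _; rewrite mulr0.
have -> : (fun (w : env R d) (v : walk d) => \sum_(r < n.+1) G r w v) =
    (fun w v => \sum_(r < n) G r w v + G n w v).
  by apply/funext => w; apply/funext => v; rewrite big_ord_recr.
have [aS hS] : adm a (fun w v => \sum_(r < n) G r w v) /\
    (avg P a (fun w v => \sum_(r < n) G r w v)%R <= n%:R%:E * b)%E.
  by apply: IH => r rn; [apply: aG|apply: hG]; exact: ltnW.
split.
  have := adm_comb (@ler01 R) (@ler01 R) aS (aG n (leqnn _)); congr adm.
  by apply/funext => w; apply/funext => v; rewrite !mul1r.
rewrite avg_add//; last exact: aG.
by rewrite -natr1 EFinD ge0_muleDl ?lee_fin// mul1e leeD// hG.
Qed.

Lemma adm_majorant n : adm (horizon n) (majorant n) /\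
  (avg P (horizon n) (majorant n) <= (rate_bound n * (m%:R *
     (2 * expR (2 * (lam * (2 * C)) ^+ 2) ^+ blocks_needed n)))%:E)%E.
Proof.
set k := blocks_needed n; set rho := expR (2 * _ ^+ 2).
have fC' a : `|- f a| <= C by rewrite normrN.
have cC' : `|\int[mu]_a (- f a)| <= C by rewrite integral_opp normrN.
have aT g r : local_function N M K g -> (r < m)%N ->
    adm (horizon n) (tilted_class P theta mu N M K g lam r k).
  by move=> gl rm; apply: adm_tilted_class => //; exact: ltnW.
have hT r : (r < m)%N ->
    (avg P (horizon n) (tilted_class P theta mu N M K f lam r k) <= (rho ^+ k)%:E)%E.
  by move=> rm; apply: (avg_tilted_class_le iidP ellP QE muE fl fC cC) => //; exact: ltnW.
have hT' r : (r < m)%N ->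
    (avg P (horizon n) (tilted_class P theta mu N M K (fun a => - f a)%R lam r k) <= (rho ^+ k)%:E)%E.
  by move=> rm; apply: (avg_tilted_class_le iidP ellP QE muE opp_fl fC' cC') => //; exact: ltnW.
have [aS hS] : adm (horizon n) (residue_sum k) /\
    (avg P (horizon n) (residue_sum k) <= m%:R%:E * (2 * rho ^+ k)%:E)%E.
  apply: (@adm_sum (horizon n) m (fun r w v => tilted_class P theta mu N M K f lam r k w v +
    tilted_class P theta mu N M K (fun a => - f a) lam r k w v)) => [|r rm|r rm].
  - by rewrite lee_fin mulr_ge0 ?exprn_ge0 ?expR_ge0.
  - have := adm_comb (@ler01 R) (@ler01 R) (aT _ _ fl rm) (aT _ _ opp_fl rm); congr adm.
    by apply/funext => w; apply/funext => v; rewrite !mul1r.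
  - rewrite (avg_add P (aT _ _ fl rm) (aT _ _ opp_fl rm)) mulrDl mul1r EFinD.
    exact: leeD (hT r rm) (hT' r rm).
split; first by apply: adm_scale => //; exact: expR_ge0.
rewrite /majorant avg_scale ?expR_ge0//.
by rewrite !EFinM lee_pmul2l ?lte_fin ?expR_gt0// -!EFinM.
Qed.

Lemma quenched_le_majorant n w : (0 < n)%N -> nn_env w ->
  (Q w (event_A mu f eps w n `&` event_D xi delta n) <=
   (path_sum (horizon n) (majorant n) w)%:E)%E.
Proof.
move=> n0 nw; have [aM _] := adm_majorant n.
apply: (quenched_le_path_sum QE nw).
- by move=> v; exact: adm_ge0 aM _ _.
- by move=> v v'; exact: (adm_walk aM).
- move=> v v' e [av dv].
  (* Observables at times below [n] look at most [K < m] steps ahead, so both events are determined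
     by the horizon. *)
  have nH : (n + m <= horizon n)%N.
    by rewrite /horizon mulnS; have := n_le_blocks n; lia.
  split; last by move: dv; rewrite /event_D/= /mean_velocity e//; lia.
  move: av; rewrite /event_A/= !big_mkord.
  rewrite (eq_bigr (fun j : 'I_n => f (Defs.shift j%:Z (v' j) w, incr R v' j)))// => j _.
  have jn := ltn_ord j; rewrite (e j); last by lia.
  have [_ _ fK _] := fl; apply: fK => i iK.
  by rewrite /incr !e//; move: nH; rewrite /m; lia.
- by move=> v [av dv] nv; exact: majorant_ge1.
Qed.

End upper_bound.

(** * Almost sure asymptotics *)

Section asymptotics.
Context (R : realType).

Lemma sum_geometric_le (q : R) n : 0 <= q -> q < 1 ->
  \sum_(0 <= i < n) q ^+ i <= (1 - q)^-1.
Proof.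
move=> q0 q1; have q1' : 0 < 1 - q by rewrite subr_gt0.
rewrite -(ler_pM2r q1') mulVf ?gt_eqF// mulrC.
have -> : (1 - q) * \sum_(0 <= i < n) q ^+ i = 1 - q ^+ n.
  elim: n => [|n IH]; first by rewrite big_nil mulr0 expr0 subrr.
  by rewrite big_nat_recr//= mulrDr IH exprS; ring.
by rewrite lerBlDr lerDl exprn_ge0.
Qed.

(** Weighting [X n] by [expR (n * (b - eta))] makes the expectations summable like a geometric
    series. The weighted series is then almost surely finite, and its sum serves as the random
    constant [B]. *)
Lemma ae_exp_bound {dT} {T : measurableType dT} (P : probability T R)
    (X : nat -> T -> R) (A b eta : R) :
    (forall n, measurable_fun setT (X n)) -> (forall n t, 0 <= X n t) ->
    (forall n, (\int[P]_t (X n t)%:E <= (A * expR (- (n%:R * b)))%:E)%E) ->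
    0 <= A -> 0 < eta ->
  {ae P, forall t, exists B, forall n, X n t <= B * expR (- (n%:R * (b - eta)))}.
Proof.
move=> mX X0 hX A0 eta0.
pose Y n t := (expR (n%:R * (b - eta)) * X n t)%:E.
have Y0 n t : (0 <= Y n t)%E by rewrite lee_fin mulr_ge0 ?expR_ge0.
have mY n : measurable_fun setT (Y n).
  by apply/measurable_EFinP; apply: measurable_funM.
pose S t := (\sum_(n <oo) Y n t)%E.
have mS : measurable_fun setT S by exact: ge0_emeasurable_sum.
have S0 t : (0 <= S t)%E by apply: nneseries_ge0 => n _ _; exact: Y0.
pose q := expR (- eta).
have q0 : 0 <= q by exact: expR_ge0.
have q1 : q < 1 by rewrite -expR0 ltr_expR oppr_lt0.
have intS : (\int[P]_t S t <= (A * (1 - q)^-1)%:E)%E.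
  rewrite /S integral_nneseries//.
  apply: lime_le.
    by apply: is_cvg_nneseries => n _ _; apply: integral_ge0 => t _; exact: Y0.
  apply: nearW => n.
  apply: (@le_trans _ _ (\sum_(0 <= i < n) (A * q ^+ i)%:E)%E).
    apply: lee_sum => i _; rewrite /Y.
    rewrite (_ : (\int[P]_t _)%E = (expR (i%:R * (b - eta)))%:E * \int[P]_t (X i t)%:E)%E; last first.
      rewrite -ge0_integralZl//; first by apply/measurable_EFinP.
      by move=> t _; exact: X0.
    apply: le_trans (lee_wpmul2l _ (hX i)) _; first by rewrite lee_fin expR_ge0.
    rewrite -EFinM lee_fin mulrCA -expRD /q -expRM_natl le_eqVlt; apply/orP; left.
    by apply/eqP; congr (_ * expR _); ring.
  by rewrite sumEFin lee_fin -mulr_sumr ler_wpM2l// sum_geometric_le.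
have : P.-integrable setT S.
  apply/integrableP; split => //.
  under eq_integral do rewrite gee0_abs//.
  exact: le_lt_trans intS (ltry _).
move=> /(integrable_ae measurableT); apply: filterS => t /(_ I) fS.
exists (fine (S t)) => n.
rewrite expRN -ler_pdivrMr ?invr_gt0 ?expR_gt0// invrK mulrC -lee_fin fineK//.
apply: le_trans (nneseries_lim_ge n.+1 (fun k _ _ => Y0 k t)).
rewrite big_nat_recr//= leeDr//.
by apply: sume_ge0 => k _; exact: Y0.
Qed.

Lemma limn_esup_le (u : nat -> \bar R) (a : \bar R) n0 :
  (forall n, (n0 <= n)%N -> (u n <= a)%E) -> (limn_esup u <= a)%E.
Proof.
move=> h; rewrite limn_esup_lim; apply: lime_le; first exact: is_cvg_esups.
exists n0 => // n /= n0n; apply: ge_ereal_sup => _ [k /= nk <-].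
by apply: h; exact: leq_trans nk.
Qed.

Lemma limn_einf_gt (u : nat -> \bar R) (a : \bar R) :
  (a < limn_einf u)%E -> exists n0, forall n, (n0 <= n)%N -> (a < u n)%E.
Proof.
rewrite limn_einf_lim (cvg_lim _ (@cvg_einfs_sup _ u))// => /ereal_sup_gt[_ [n0 _ <-] h].
exists n0 => n n0n; apply: lt_le_trans h _.
by apply: ereal_inf_lbound; exists n.
Qed.

Lemma lt_exp_of_lne (q : \bar R) (n : nat) (a : R) : (0 < n)%N -> q \is a fin_num ->
  (a%:E < n%:R^-1%:E * lne q)%E -> expR (n%:R * a) < fine q.
Proof.
case: q => // q n0 _; rewrite [fine _]/=; have n0' : 0 < n%:R :> R by rewrite ltr0n.
have [q0|q0] := ltP 0 q.
  by rewrite lne_EFin// -EFinM lte_fin ltr_pdivlMl// -[in X in _ -> X](lnK q0) ltr_expR.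
by rewrite le0_lneNy ?lee_fin// gt0_muleNy ?lte_fin ?invr_gt0// ltNge leNye.
Qed.

Lemma lne_le_of_exp (q : R) (n : nat) (a : R) : (0 < n)%N ->
  q <= expR (n%:R * a) -> (n%:R^-1%:E * lne q%:E <= a%:E)%E.
Proof.
move=> n0 qa; have n0' : 0 < n%:R :> R by rewrite ltr0n.
(* When [q] is not positive the logarithm is -oo and the bound is trivial. *)
have [q0|q0] := ltP 0 q.
  by rewrite lne_EFin// -EFinM lee_fin ler_pdivrMl// -ler_expR lnK ?posrE.
by rewrite le0_lneNy ?lee_fin// gt0_muleNy ?lte_fin ?invr_gt0// leNye.
Qed.

End asymptotics.

(** * Lower bound for the conditioning event from the quenched LDP *)

Section lower_bound.
Context (R : realType) (d : nat) (P : probability (env R d) R).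
Hypotheses (ellP : uniformly_elliptic P).
Context (Q : env R d -> probability (walk d) R).
Implicit Types (w : env R d) (v : walk d).

(** The library ball is a sup-norm ball; with radius [delta / d.+1] the sum of the [d.+1] squares is
    at most [delta ^+ 2 / d.+1]. *)
Lemma ball_enorm (xi x : 'rV[R]_d.+1) delta : 0 < delta ->
  ball xi (delta / d.+1%:R) x -> enorm (x - xi) <= delta.
Proof.
move=> delta0 hx; have d0 : 0 < d.+1%:R :> R by rewrite ltr0n.
have d1 : 1 <= d.+1%:R :> R by rewrite ler1n.
rewrite [leRHS](_ : delta = Num.sqrt (delta ^+ 2)); last first.
  by rewrite sqrtr_sqr ger0_norm// ltW.
rewrite /enorm ler_wsqrtr//.
apply: (@le_trans _ _ (\sum_(i < d.+1) (delta / d.+1%:R) ^+ 2)).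
  apply: ler_sum => i _; rewrite !mxE -expr2 -real_normK ?num_real//.
  have [_ /(_ 0 i)] := hx; rewrite /ball/= => hi.
  have r0 : 0 <= delta / d.+1%:R by rewrite divr_ge0 ?ltW.
  by rewrite lerXn2r ?nnegrE// distrC ltW.
rewrite sumr_const card_ord -[leLHS]mulr_natl.
rewrite (_ : _ * _ = delta ^+ 2 / d.+1%:R); last by field; rewrite gt_eqF.
by rewrite ler_pdivrMr// ler_peMr ?sqr_ge0.
Qed.

(** The LDP is applied to an open neighbourhood of [xi] inside both its domain and the conditioning
    ball. The infimum there is at most [I_a P xi], bounded by [I_a_le], and the slack [eta] makes
    the inequality strict. *)
Lemma event_D_lower_bound (xi theta : 'rV[R]_d.+1) delta eta :
    quenched_ldp_near P Q xi -> xi = gradient (log_phi P) theta ->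
    0 < delta -> 0 < eta ->
  {ae P, forall w, exists n0, forall n, (n0 <= n)%N -> (0 < n)%N ->
    expR (n%:R * (- (dot theta xi - log_phi P theta) - eta)) <
    fine (Q w (event_D xi delta n))}.
Proof.
move=> [U [I [[oU Uxi] _ _ Ixi hldp]]] xiE delta0 eta0.
have r0 : 0 < delta / d.+1%:R by rewrite divr_gt0// ltr0n.
pose G := U `&` (ball xi (delta / d.+1%:R))°.
have oG : open G by apply: openI => //; exact: open_interior.
have Gxi : G xi by split => //; exact: nbhsx_ballx.
apply: filterS hldp => w [/(_ G oG (@subIsetl _ _ _)) hG _].
have : ((- (dot theta xi - log_phi P theta) - eta)%:E <
   limn_einf (fun n => n%:R^-1%:E * lne (Q w [set v | G (mean_velocity R n v)])))%E.
  apply: lt_le_trans hG.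
  apply: (@lt_le_trans _ _ (- (dot theta xi - log_phi P theta))%:E).
    by rewrite lte_fin ltrBlDr ltrDl.
  rewrite EFinN leeN2; apply: le_trans (I_a_le ellP xiE); rewrite -Ixi.
  by apply: ereal_inf_lbound; exists xi.
move=> /limn_einf_gt[n0 hn0]; exists n0 => n n0n npos.
have mG : measurable [set v : walk d | G (mean_velocity R n v)].
  by apply: (@measurable_local _ n) => v v' e /=; rewrite /mean_velocity e.
have mD : measurable (event_D xi delta n : set (walk d)).
  by apply: (@measurable_local _ n) => v v' e; rewrite /event_D/= /mean_velocity e.
apply: lt_le_trans (lt_exp_of_lne npos _ (hn0 n n0n)) _.
  exact: fin_num_measure.
apply: fine_le; [exact: fin_num_measure|exact: fin_num_measure|].
apply: le_measure; rewrite ?inE// => v [_ /interior_subset]; exact: ball_enorm.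
Qed.

End lower_bound.

Lemma chernoff_parameter (R : realType) (s e m : R) : 0 < s -> 0 < e -> 0 < m ->
  exists2 lam : R, 0 < lam &
    lam * s <= 1 / 2 /\ 2 * (lam * s) ^+ 2 <= 2 * (lam * e / (4 * m)).
Proof.
(* With [lam = D^-1], the first summand of [D] yields [lam * s <= 1 / 2] and the second makes the
   quadratic term small compared with the linear gain. *)
move=> s0 e0 m0; pose D := 2 * s + 4 * m * s ^+ 2 / e.
have s2 : 0 < s ^+ 2 by rewrite exprn_gt0.
have t0 : 0 < 4 * m * s ^+ 2 / e by rewrite divr_gt0// !mulr_gt0.
have D0 : 0 < D by rewrite addr_gt0// mulr_gt0.
exists D^-1; first by rewrite invr_gt0.
split; first by rewrite mulrC ler_pdivrMr// /D; lra.
have h : 4 * m * s ^+ 2 <= D * e.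
  by rewrite -ler_pdivrMr// /D lerDr mulr_ge0// ltW.
rewrite ler_pM2l// exprMn expr2 -!mulrA ler_pM2l ?invr_gt0//.
by rewrite mulrC ler_pdivrMr// mulrC mulrA ler_pdivlMr ?mulr_gt0//; move: h; lra.
Qed.

(** * The averaged decay rate *)

Section rate.
Context (R : realType) (d : nat) (P : probability (env R d) R).
Hypotheses (iidP : iid_env P) (ellP : uniformly_elliptic P).
Context (Q : env R d -> probability (walk d) R).
Hypothesis QE : forall w, quenched_law w 0 0 (Q w).
Variables (theta xi : 'rV[R]_d.+1).
Context (mu : probability (env R d * steps R d)%type R).
Hypothesis muE : is_mubar P Q theta mu.
Variables (N M K : nat) (f : env R d * steps R d -> R).
Hypothesis fl : local_function N M K f.

Let m := (N + M + K).+1.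

(** Per unit of time the Chernoff threshold gains [4 * kap], the exponential moments cost at most
    [2 * kap] and the width [delta] at most [kap]. A net gain of [kap] over the exponent of the
    conditioning event remains. *)
Lemma avg_majorant_le (C lam eps delta kap : R) n :
    (forall a, `|f a| <= C) -> `|\int[mu]_a f a| <= C -> 0 <= lam ->
    lam * (2 * C) <= 1 / 2 ->
    kap = lam * eps / (4 * m%:R) -> 2 * (lam * (2 * C)) ^+ 2 <= 2 * kap ->
    delta * norm1 theta <= kap ->
  (avg P (m * (n %/ m).+2) (majorant P theta xi mu N M K f C lam eps delta n) <=
   (m%:R * 2 * expR ((2 * m)%:R * (norm1 theta + `|log_phi P theta|) +
      lam * ((2 * C) * (2 * N + m)%:R / m%:R) + 2 * kap) *
    expR (- (n%:R * (dot theta xi - log_phi P theta + kap))))%:E)%E.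
Proof.
move=> fC cC lam0 lamC kapE lk dk.
have [_ h] := adm_majorant iidP ellP QE xi muE fl eps delta fC cC lam0 lamC n.
apply: (le_trans h); rewrite lee_fin mulrCA -!mulrA ler_wpM2l// mulrCA ler_wpM2l//.
rewrite /rate_bound -expRM_natl -!expRD ler_expR.
set J := dot theta xi - _; set T := norm1 theta + _.
have kap0 : 0 <= kap.
  by move: lk; have := sqr_ge0 (lam * (2 * C)); lra.
have n0 : 0 <= n%:R :> R by [].
(* The number of blocks is bounded by [n + 1]; the extra one enters the constant prefactor. *)
have kn : (n %/ m).+1%:R * (2 * (lam * (2 * C)) ^+ 2) <= n%:R * (2 * kap) + 2 * kap.
  apply: (@le_trans _ _ ((n %/ m).+1%:R * (2 * kap))); first by rewrite ler_wpM2l.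
  rewrite -{3}[2 * kap]mul1r -mulrDl ler_wpM2r//; first by rewrite mulr_ge0.
  by rewrite natr1 ler_nat ltnS leq_div.
have dn : n%:R * (delta * norm1 theta) <= n%:R * kap by rewrite ler_wpM2l.
have -> : lam * ((n%:R * eps - 2 * C * (2 * N + m)%:R) / m%:R) =
    n%:R * (4 * kap) - lam * (2 * C * (2 * N + m)%:R / m%:R).
  have : m%:R != 0 :> R by rewrite pnatr_eq0.
  rewrite kapE; move: (m%:R) (_ + _)%:R => x y x0; by field.
rewrite -/m; move: kn dn.
move: (2 * m)%:R (2 * N + m)%:R (m%:R^-1) (_.+1%:R) => x y z k kn dn; lra.
Qed.

End rate.

Theorem theorem3 (R : realType) (d : nat)
  (P : probability (env R d) R)
  (hiid : iid_env P) (hnn : nearest_neighbor P) (hue : uniformly_elliptic P)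
  (Q : env R d -> probability (walk d) R)
  (hQ : forall w, quenched_law w 0 0 (Q w))
  (xi : 'rV[R]_d.+1) (hxi : (domain_I_a P)° xi)
  (hldp : quenched_ldp_near P Q xi)
  (theta : 'rV[R]_d.+1) (htheta : xi = gradient (log_phi P) theta)
  (mu : probability (env R d * steps R d)%type R)
  (hmu : is_mubar P Q theta mu)
  (N M K : nat) (f : env R d * steps R d -> R) (hf : local_function N M K f)
  (eps : R) (heps : 0 < eps) :
  exists2 delta0 : R, 0 < delta0 &
    forall delta : R, 0 < delta -> delta < delta0 ->
      {ae P, forall w,
        (limn_esup (fun n =>
           n%:R^-1%:E *
           lne (cond_prob (Q w) (event_A mu f eps w n)
                  (event_D xi delta n))%:E) < 0)%E}.
Proof.
pose m := (N + M + K).+1; have m0 : 0 < m%:R :> R by rewrite ltr0n.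
have [[C0 hC0] _ _ _] := hf.
(* The summand 1 makes [C] positive, as [chernoff_parameter] requires. *)
pose C := `|C0| + `|\int[mu]_a f a| + 1.
have C1 : 0 < C by rewrite ltr_wpDl// addr_ge0.
have fC a : `|f a| <= C.
  rewrite (le_trans (hC0 a))// (le_trans (ler_norm _))// /C -addrA lerDl addr_ge0//.
have cC : `|\int[mu]_a f a| <= C by rewrite /C addrAC lerDr addr_ge0.
have [lam lam0 [lamC lk]] : exists2 lam : R, 0 < lam & lam * (2 * C) <= 1 / 2 /\
    2 * (lam * (2 * C)) ^+ 2 <= 2 * (lam * eps / (4 * m%:R)).
  by apply: chernoff_parameter => //; rewrite mulr_gt0.
pose kap := lam * eps / (4 * m%:R).
have kap0 : 0 < kap by rewrite divr_gt0 ?mulr_gt0.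
have nn := norm1_ge0 theta.
(* Both [lam] and [kap] are fixed before [delta]. This threshold keeps the cost
   [delta * norm1 theta] below [kap]; adding 1 covers a vanishing [theta]. *)
exists (kap / (norm1 theta + 1)); first by rewrite divr_gt0// ltr_wpDl.
move=> delta delta0; rewrite ltr_pdivlMr ?ltr_wpDl// => hdelta.
have dk : delta * norm1 theta <= kap by move: hdelta; rewrite mulrDr; lra.
pose J := dot theta xi - log_phi P theta.
pose A := m%:R * 2 * expR ((2 * m)%:R * (norm1 theta + `|log_phi P theta|) +
  lam * ((2 * C) * (2 * N + m)%:R / m%:R) + 2 * kap).
pose V n := path_sum (m * (n %/ m).+2) (majorant P theta xi mu N M K f C lam eps delta n).
have aV n : adm (m * (n %/ m).+2) (majorant P theta xi mu N M K f C lam eps delta n).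
  exact: (adm_majorant hiid hue hQ xi hmu hf eps delta fC cC (ltW lam0) lamC n).1.
have bound : {ae P, forall w, exists B, forall n,
    V n w <= B * expR (- (n%:R * (J + kap - kap / 2)))}.
  apply: (@ae_exp_bound _ _ _ P V A).
  - by move=> n; exact: measurable_path_sum (adm_meas (aV n)).
  - by move=> n w; apply: path_sum_ge0; exact: adm_ge0 (aV n).
  - move=> n; exact: (avg_majorant_le hiid hue hQ xi hmu hf n fC cC (ltW lam0) lamC erefl lk dk).
  - by rewrite /A mulr_ge0 ?expR_ge0.
  - by rewrite divr_gt0.
have kap4 : 0 < kap / 4 by rewrite divr_gt0.
have lower := event_D_lower_bound hue hldp htheta delta0 kap4.
have nnw := ae_nn_env hiid hnn.
apply: filterS3 bound lower nnw => w [B hB] [n0 hD] nw.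
(* The joint event decays at rate [J + kap / 2] and the conditioning event at most at rate
   [J + kap / 4]. Half of the difference [kap / 4] absorbs the random constant. *)
apply: (@le_lt_trans _ _ (- (kap / 8))%:E); last first.
  by rewrite lte_fin oppr_lt0 divr_gt0.
(* The maximum makes the logarithm of the constant meaningful; from [n1] on this logarithm is at
   most [n * (kap / 8)]. *)
pose B1 := Num.max B 1; have B10 : 0 < B1 by rewrite lt_max ltr01 orbT.
pose n1 := (Num.truncn (ln B1 / (kap / 8))).+1.
apply: (@limn_esup_le _ _ _ (maxn 1 (maxn n0 n1))) => n.
rewrite !geq_max => /andP[npos /andP[nn0 nn1]].
apply: lne_le_of_exp => //.
have hDn := hD n nn0 npos.
have D0 : 0 < fine (Q w (event_D xi delta n)) by apply: lt_trans hDn; exact: expR_gt0.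
rewrite /cond_prob ler_pdivrMr//.
have AD : fine (Q w (event_A mu f eps w n `&` event_D xi delta n)) <= V n w.
  have h := quenched_le_majorant hiid hue hQ xi hmu hf eps delta fC cC
    (ltW lam0) lamC npos nw.
  by rewrite -lee_fin fineK// ge0_fin_numE// (le_lt_trans h)// ltry.
apply: (le_trans AD); apply: (le_trans (hB n)).
apply: (@le_trans _ _ (expR (n%:R * - (kap / 8)) * expR (n%:R * (- J - kap / 4)))); last first.
  by rewrite ler_wpM2l ?expR_ge0// ltW.
apply: (@le_trans _ _ (B1 * expR (- (n%:R * (J + kap - kap / 2))))).
  by rewrite ler_wpM2r ?expR_ge0// le_max lexx.
rewrite -[B1]lnK ?posrE// -!expRD ler_expR.
have : ln B1 <= n%:R * (kap / 8).
  have k8 : 0 < kap / 8 by rewrite divr_gt0.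
  rewrite -(ler_pdivrMr _ _ k8); apply: (@le_trans _ _ n1%:R); last by rewrite ler_nat.
  by apply: ltW; exact: truncnS_gt.
by rewrite /J; lra.
Qed.
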